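(* For every $k\ge1$ and every tuple of partitions $\nu=(\nu_1^+,\nu_1^-,\dots,\nu_k^+,\nu_k^-)$, $$m^\infty_\nu(q,k)=\sum_{T\in D(\nu)}q^{\sum_{i=1}^k|\lambda_i(T)|}.$$
   Context: Identify a partition $\lambda=(a_1\ge a_2\ge\cdots)$ with $\sum_ja_j\epsilon_j$ in $\Lambda=\bigoplus_{j\ge1}\mathbb Z\epsilon_j$; put $\omega_i=\epsilon_1+\dots+\epsilon_i$; partitions are exactly elements with all $\omega$-coordinates $\ge0$. For $x,y\in\Lambda$, $y\le x$ means $x-y$ has all $\omega$-coordinates $\ge0$. $\mathcal P$ = partitions, $\mathcal P^k$ = $k$-tuples; $|\lambda|$ = number of boxes. $SST(\nu)$ = semistandard tableaux of shape $\nu$ with entries in $\mathbb Z_{>0}$, with the standard $\mathfrak{gl}_\infty$-crystal structure. For $T\in SST(\nu)$: $\mathrm{wt}(T)=\sum_j(\#\text{entries }j)\epsilon_j$, $\varepsilon_i(T)=\max\{m\ge0:\tilde e_i^mT\ne0\}$, $\varepsilon(T)=\sum_i\varepsilon_i(T)\omega_i$. $\mathrm{CLR}^\lambda_{\alpha,\nu}=\{T\in SST(\nu):\varepsilon(T)\le\alpha,\ \alpha+\mathrm{wt}(T)=\lambda\}$; it is known that $|\mathrm{CLR}^\lambda_{\alpha,\nu}|=c^\lambda_{\alpha,\nu}$ (Littlewood–Richardson coefficient). Indices cyclic mod $k$ with representatives $1,\dots,k$ ($\lambda_0:=\lambda_k$). $\underline{SST}(\nu)=\prod_iSST(\nu_i^+)\times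 SST(\nu_i^-)$, $T=(T_1^+,T_1^-,\dots,T_k^+,T_k^-)$, $\mathrm{wt}(T_i)=\mathrm{wt}(T_i^+)-\mathrm{wt}(T_i^-)$. $\underline{\mathrm{CLR}}^\lambda_{\alpha,\nu}=\prod_{i=1}^k\mathrm{CLR}^{\lambda_i}_{\alpha_i,\nu_i^+}\times\mathrm{CLR}^{\lambda_{i-1}}_{\alpha_i,\nu_i^-}$ for $\lambda,\alpha\in\mathcal P^k$. $D(\nu)$ = set of distinguished $T$, i.e. those lying in some $\underline{\mathrm{CLR}}^\lambda_{\alpha,\nu}$ (equivalently $\sum_j\mathrm{wt}(T_j)=0$). For $T\in D(\nu)$, $\lambda_{\min}(T)$ is the coordinatewise (in $\omega$-coordinates) maximum of $S_i^\pm=\varepsilon(T_i^\pm)+\mathrm{wt}(T_i^+)-\sum_{j=2}^i\mathrm{wt}(T_j)$, $i=1,\dots,k$, and $\lambda_i(T)=\lambda_{\min}(T)+\sum_{j=2}^i\mathrm{wt}(T_j)$ (a partition). The stable $q$-multiplicity is the formal power series $$m^\infty_\nu(q,k)=\Big[\prod_{i=1}^\infty(1-q^{ki})\Big]\sum_{\alpha,\lambda\in\mathcal P^k}q^{\sum_i|\lambda_i|}\prod_{i=1}^kc^{\lambda_i}_{\alpha_i,\nu_i^+}c^{\lambda_{i-1}}_{\alpha_i,\nu_i^-}.$$ (Motivation: for the cyclic quiver action of $K=\prod_i\mathbf{GL}_{n_i}$ on $\bigoplus_i\mathrm{Hom}(\mathbb C^{n_i},\mathbb C^{n_{i+1}})$,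 this agrees with the graded multiplicity of the $K$-type $\nu$ in the harmonic polynomials up to degree $\min_i n_i$.) *)

(* Defs.v *)
From mathcomp Require Import all_boot all_order all_algebra.
Set Implicit Arguments. Unset Strict Implicit. Unset Printing Implicit Defensive.
Import Order.TTheory GRing.Theory Num.Theory.

Definition is_part (s : seq nat) : bool := sorted geq s && all (fun x => 0 < x) s.

(* ---------- semistandard tableaux (English notation, rows top to bottom) ---------- *)
Definition tableau := seq (seq nat).
Definition shape (t : tableau) : seq nat := map size t.

Definition is_SST (nu : seq nat) (t : tableau) : bool :=
  [&& shape t == nu,
      all (fun r => all (fun x => 0 < x) r) t,
      all (fun r => sorted leq r) t &
      all (fun r => all (fun c => nth 0 (nth [::] t r) c < nth 0 (nth [::] t r.+1) c)
                        (iota 0 (size (nth [::] t r.+1))))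
          (iota 0 (size t).-1)].

Definition rword (t : tableau) : seq nat := flatten (rev t).

(* signature rule: letters i.+1 are "(" and letters i are ")";
   returns the stack (most recent first) of positions of unmatched i.+1's *)
Fixpoint unm_aux (i : nat) (w : seq nat) (pos : nat) (stk : seq nat) : seq nat :=
  match w with
  | [::] => stk
  | x :: w' =>
      if x == i.+1 then unm_aux i w' pos.+1 (pos :: stk)
      else if x == i then unm_aux i w' pos.+1 (behead stk)
      else unm_aux i w' pos.+1 stk
  end.

(* Kashiwara operator e_i on words: change the leftmost unmatched i+1 into i *)
Definition e_word (i : nat) (w : seq nat) : option (seq nat) :=
  match unm_aux i w 0 [::] with
  | [::] => None
  | p :: s => Some (set_nth 0 w (last p s) i)
  end.

(* e_i on tableaux, through the reading word (None plays the role of 0) *)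
Definition eT (i : nat) (t : tableau) : option tableau :=
  omap (fun w => rev (reshape (rev (shape t)) w)) (e_word i (rword t)).

Definition eiter (i m : nat) (t : tableau) : option tableau :=
  iter m (obind (eT i)) (Some t).

(* eps_i(T) = max { m >= 0 : e_i^m T <> 0 }; e_i lowers the number of letters
   i+1, so m never exceeds the number of boxes. *)
Definition eps (i : nat) (t : tableau) : nat :=
  \max_(m < (size (rword t)).+1 | eiter i m t != None) m.

(* ---------- the weight lattice Lambda = (+)_{j>=1} Z eps_j ---------- *)
(* an element is given by its coordinates x j, j >= 1 (x 0 is ignored) *)
Definition vec := nat -> int.

Definition pv (lam : seq nat) : vec := fun j => Posz (nth 0 lam j.-1).

Definition wt (t : tableau) : vec := fun j => Posz (count_mem j (flatten t)).

Definition maxent (t : tableau) : nat := \max_(x <- flatten t) x.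

(* eps(T) = sum_i eps_i(T) omega_i ; eps_i(T) = 0 for i >= maxent t *)
Definition epsv (t : tableau) : vec :=
  fun j => (\sum_(j <= i < (maxent t).+1) Posz (eps i t))%R.

(* omega-coordinates: x = sum_i (x_i - x_{i+1}) omega_i *)
Definition omc (x : vec) (i : nat) : int := (x i - x i.+1)%R.

Definition leL (y x : vec) : Prop :=
  forall i, (0 < i)%N -> (0 <= omc (fun j => x j - y j)%R i)%R.

Definition CLR (lam al nu : seq nat) (t : tableau) : Prop :=
  [/\ is_SST nu t, leL (epsv t) (pv al) &
      forall j, (0 < j)%N -> (pv al j + wt t j)%R = pv lam j].

(* ---------- k-tuples, cyclic indices (0-based: index r stands for i = r+1) ---------- *)
Definition prevI (k r : nat) : nat := if r is r'.+1 then r' else k.-1.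

Definition is_partk (k : nat) (l : seq (seq nat)) : bool :=
  (size l == k) && all is_part l.

(* T = (T_1^+,T_1^-,...,T_k^+,T_k^-) as the list [:: (T_1^+,T_1^-); ...] *)
Definition ttab := seq (tableau * tableau).

Definition distinguished (k : nat) (nu : seq (seq nat * seq nat)) (T : ttab) : Prop :=
  size T = k /\
  exists lam al : seq (seq nat),
    [/\ is_partk k lam, is_partk k al &
        forall r, (r < k)%N ->
          CLR (nth [::] lam r) (nth [::] al r) (nth ([::], [::]) nu r).1
              (nth ([::], [::]) T r).1 /\
          CLR (nth [::] lam (prevI k r)) (nth [::] al r) (nth ([::], [::]) nu r).2
              (nth ([::], [::]) T r).2].

Definition wtT (T : ttab) (s : nat) : vec :=
  fun j => (wt (nth ([::], [::]) T s).1 j - wt (nth ([::], [::]) T s).2 j)%R.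

(* sum_{j=2}^{i} wt(T_j), for i = r+1 *)
Definition cumw (T : ttab) (r : nat) : vec :=
  fun j => (\sum_(1 <= s < r.+1) wtT T s j)%R.

Definition Sp (T : ttab) (r : nat) : vec :=
  fun j => (epsv (nth ([::], [::]) T r).1 j + wt (nth ([::], [::]) T r).1 j - cumw T r j)%R.
Definition Sm (T : ttab) (r : nat) : vec :=
  fun j => (epsv (nth ([::], [::]) T r).2 j + wt (nth ([::], [::]) T r).1 j - cumw T r j)%R.

Definition Svecs (T : ttab) : seq vec :=
  flatten [seq [:: Sp T r; Sm T r] | r <- iota 0 (size T)].

Fixpoint maxl (l : seq int) : int :=
  match l with
  | [::] => 0
  | [:: x] => x
  | x :: l' => Num.max x (maxl l')
  end.

(* 1 + the largest entry occurring in T; all vectors below vanish beyond it *)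
Definition bndT (T : ttab) : nat :=
  (\max_(p <- T) maxn (maxent p.1) (maxent p.2)).+1.

(* lambda_min(T): omega-coordinates are the max of those of the S_i^{+-} *)
Definition lmin (T : ttab) : vec :=
  fun j => (\sum_(j <= i < bndT T) maxl [seq omc V i | V <- Svecs T])%R.

Definition lamT (T : ttab) (r : nat) : vec := fun j => (lmin T j + cumw T r j)%R.

(* number of boxes |x| = sum_j x_j for x supported in [1, N) *)
Definition vsize (N : nat) (x : vec) : int := (\sum_(1 <= j < N) x j)%R.

Definition expo (T : ttab) : int :=
  (\sum_(r < size T) vsize (bndT T) (lamT T r))%R.

Fixpoint prodseq (X : Type) (k : nat) (s : seq X) : seq (seq X) :=
  match k with
  | 0 => [:: [::]]
  | k'.+1 => [seq x :: t | x <- s, t <- prodseq k' s]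
  end.

Definition subpart (al lam : seq nat) : bool :=
  (size al <= size lam) && all (fun r => nth 0 al r <= nth 0 lam r) (iota 0 (size lam)).

Definition lattice (u : seq nat) : bool :=
  all (fun p => all (fun j => count_mem j.+2 (take p u) <= count_mem j.+1 (take p u))
                    (iota 0 (\max_(x <- u) x)))
      (iota 0 (size u).+1).

(* w lists the entries of a filling of the skew shape lam/al row by row
   (top to bottom, left to right) *)
Definition LRfill (lam al nu : seq nat) (w : seq nat) : bool :=
  let rl := [seq nth 0 lam r - nth 0 al r | r <- iota 0 (size lam)] in
  let rows := reshape rl w in
  let ent r c := nth 0 (nth [::] rows r) (c - nth 0 al r) in
  [&& size w == sumn rl,
      all (fun x => 0 < x <= size nu) w,
      all (fun r => sorted leq r) rows,
      all (fun r => all (fun c => (nth 0 al r <= c) ==> (ent r c < ent r.+1 c))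
                        (iota (nth 0 al r.+1) (nth 0 lam r.+1 - nth 0 al r.+1)))
          (iota 0 (size lam).-1),
      [seq count_mem j.+1 w | j <- iota 0 (size nu)] == nu &
      lattice (flatten (map rev rows))].

Definition LR (lam al nu : seq nat) : nat :=
  if subpart al lam then
    count (LRfill lam al nu) (prodseq (sumn lam - sumn al) (iota 1 (size nu)))
  else 0.

Fixpoint seqs (b l : nat) : seq (seq nat) :=
  match l with
  | 0 => [:: [::]]
  | l'.+1 => [::] :: [seq x :: s | x <- iota 1 b, s <- seqs b l']
  end.

Definition parts (m : nat) : seq (seq nat) :=
  undup [seq s <- seqs m m | is_part s && (sumn s == m)].

Definition partsle (n : nat) : seq (seq nat) :=
  flatten [seq parts m | m <- iota 0 n.+1].

(* coefficient of q^n in sum_{al,lam} q^{sum|lam_i|} prod_i c c;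
   c^{lam_i}_{al_i,.} = 0 unless al_i is contained in lam_i, so |al_i| <= n *)
Definition Acoef (k : nat) (nu : seq (seq nat * seq nat)) (n : nat) : int :=
  (\sum_(lam <- prodseq k (partsle n) | \sum_(l <- lam) sumn l == n)
   \sum_(al <- prodseq k (partsle n))
    \prod_(r < k)
      Posz ((LR (nth [::] lam r) (nth [::] al r) (nth ([::], [::]) nu r).1
        * LR (nth [::] lam (prevI k r)) (nth [::] al r) (nth ([::], [::]) nu r).2)%N))%R.

(* coefficient of q^n in prod_{i>=1} (1 - q^{k i}) (factors with i > n are irrelevant
   when k >= 1) *)
Definition Pcoef (k n : nat) : int :=
  ((\prod_(1 <= i < n.+1) (1 - 'X^(k * i)) : {poly int})`_n)%R.

Definition minf (k : nat) (nu : seq (seq nat * seq nat)) (n : nat) : int :=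
  (\sum_(j < n.+1) Pcoef k j * Acoef k nu (n - j)%N)%R.

(* Main.v *)
Require Import Defs.
From mathcomp Require Import all_boot all_order all_algebra zify.
Import Order.TTheory GRing.Theory Num.Theory.
Set Implicit Arguments. Unset Strict Implicit. Unset Printing Implicit Defensive.

(* The entry counts of a semistandard tableau and of a Littlewood-Richardson
   filling are transposes of each other; under this transposition column
   strictness on either side becomes, respectively, the lattice condition and
   the bound eps(T) <= alpha, so LR(lambda, alpha, nu) = |CLR|.  Hence the double
   series is a sum over tuples T of the number of (lambda, alpha) compatible
   with T.  For T distinguished these are exactly lambda_i = lambda_i(T) + mu,
   alpha_i = lambda_i - wt(T_i^+), with mu an arbitrary partition: T contributes
   q^(sum |lambda_i(T)|) * sum_mu q^(k |mu|), and the last factor is cancelled by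
   the Euler product prod_i (1 - q^(k i)). *)

(** * Unmatched letters and string lengths *)

(** The three conditions to be matched are defined very differently: the string length by iterating
    an operator until it returns [None], the lattice condition by prefixes, strictness by columns.
    Each is reduced to the same kind of inequality, comparing a letter count over r+1 rows with one
    over r rows. For the crystal side, eps_i is the number of unmatched letters i+1, which is the
    largest excess of i+1 over i in a suffix of the reading word; weakly increasing rows leave only
    suffixes adapted to rows. The form of lambda_min comes from eliminating alpha_i between the
    weight equations of T_i^+ and T_i^-: this gives lambda_i - lambda_(i-1) = wt(T_i), so lambda_1
    determines the whole tuple, and one turn around the cycle forces the total weight to vanish. The
    bounds on eps then become lower bounds S_i^+ and S_i^- on lambda_1, whose least common solution
    is lambda_min. Everything is done coefficientwise: entries of T are at most the length of some
    lambda_i, hence at most n in degree n, so finite lists suffice. *)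

Lemma unm_aux_rcons i w x pos stk :
  unm_aux i (rcons w x) pos stk =
    let s := unm_aux i w pos stk in
    if x == i.+1 then pos + size w :: s
    else if x == i then behead s else s.
Proof.
elim: w pos stk => [|y w IHw] pos stk /=; first by rewrite addn0.
by rewrite !IHw addSnnS; case: ifP => // _; case: ifP.
Qed.

Lemma set_nth_rcons (T : Type) (x0 : T) s x y p :
  p < size s -> set_nth x0 (rcons s x) p y = rcons (set_nth x0 s p y) x.
Proof. by elim: s p => [|z s IHs] [|p] //= lt_p; rewrite IHs. Qed.

Lemma set_nth_rcons_last (T : Type) (x0 : T) s x y :
  set_nth x0 (rcons s x) (size s) y = rcons s y.
Proof. by elim: s => [|z s IHs] //=; rewrite IHs. Qed.

(** The bottom [q] of the final stack was pushed on an empty stack and never popped. Turned into i,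
    the letter at [q] meets an empty stack and does nothing, and the rest of the run is unchanged
    except that the bottom entry is missing. *)
Lemma unm_set_nth i w s q : unm_aux i w 0 [::] = rcons s q ->
  q < size w /\ unm_aux i (set_nth 0 w q i) 0 [::] = s.
Proof.
elim/last_ind: w s q => [|w x IHw] s q; first by case: s.
have step s' : unm_aux i w 0 [::] = rcons s' q ->
    q < size (rcons w x) /\ unm_aux i (set_nth 0 (rcons w x) q i) 0 [::] =
    (if x == i.+1 then size w :: s' else if x == i then behead s' else s').
  move=> /IHw[lt_q def_s']; rewrite size_rcons ltnS ltnW //; split=> //.
  rewrite set_nth_rcons // unm_aux_rcons def_s' /= add0n.
  by rewrite size_set_nth (maxn_idPr lt_q).
rewrite unm_aux_rcons /= add0n.
case def_u: (unm_aux i w 0 [::]) => [|y u].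
  case: eqP => [->|_]; last by case: eqP => _; case: s {step}.
  case: s {step} => [|? [|? ?]] //= [<-].
  by rewrite size_rcons set_nth_rcons_last unm_aux_rcons def_u /= ltn_eqF // eqxx.
rewrite def_u lastI in step.
case: eqP step => [-> | _] step.
  rewrite lastI => /rcons_inj[<- def_q].
  by apply: step; rewrite def_q.
case: eqP step => [_ | _] step; last by rewrite lastI => ?; apply: step.
by move=> /= def_u'; rewrite -lastI def_u' in step; apply: (step (y :: s)).
Qed.

Lemma size_unm_e_word i w : size (unm_aux i w 0 [::]) =
  if e_word i w is Some w' then (size (unm_aux i w' 0 [::])).+1 else 0.
Proof.
rewrite /e_word; case def_u: unm_aux => [|p s] //.
have [_ ->] := @unm_set_nth i w _ _ (etrans def_u (lastI p s)).
by rewrite size_belast.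
Qed.

Lemma size_e_word i w w' : e_word i w = Some w' -> size w' = size w.
Proof.
rewrite /e_word; case def_u: unm_aux => [|p s] // [<-].
have [lt_q _] := @unm_set_nth i w _ _ (etrans def_u (lastI p s)).
by rewrite size_set_nth (maxn_idPr lt_q).
Qed.

Lemma rword_eT i t :
  omap rword (eT i t) = e_word i (rword t).
Proof.
rewrite /eT; case def_w: e_word => [w|] //=; congr Some.
rewrite /rword revK reshapeKr // (size_e_word def_w) /rword size_flatten.
by rewrite /shape map_rev.
Qed.

(** Each application of [eT] uses up exactly one unmatched letter i+1, so the iteration dies after
    as many steps as there are such letters. *)
Lemma eiter_neq_None i m t :
  (eiter i m t != None) = (m <= size (unm_aux i (rword t) 0 [::])).
Proof.
rewrite /eiter; elim: m t => [|m IHm] t //.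
rewrite iterSr /= size_unm_e_word -rword_eT.
case: (eT i t) => [t'|] /=; first by rewrite IHm.
by rewrite iter_fix.
Qed.

Lemma size_unm_aux i w pos stk :
  size (unm_aux i w pos stk) <= size stk + size w.
Proof.
elim/last_ind: w => [|w x]; first by rewrite addn0.
rewrite unm_aux_rcons /= size_rcons; do 2?case: ifP; rewrite /= ?size_behead; lia.
Qed.

Definition unm i w := size (unm_aux i w 0 [::]).

Lemma epsE i t : eps i t = unm i (rword t).
Proof.
rewrite /eps /unm; set u := size (unm_aux _ _ _ _).
have le_u: u < (size (rword t)).+1 by rewrite ltnS size_unm_aux.
apply/eqP; rewrite eqn_leq; apply/andP; split.
  by apply/bigmax_leqP => m; rewrite eiter_neq_None.
by apply: (leq_bigmax_cond (Ordinal le_u)); rewrite eiter_neq_None.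
Qed.

Lemma unm_nil i : unm i [::] = 0. Proof. by []. Qed.

Lemma unm_rcons i w x : unm i (rcons w x) = unm i w + (x == i.+1) - (x == i).
Proof.
rewrite /unm unm_aux_rcons /=; case: eqP => [->|_] /=.
  by rewrite addn1 gtn_eqF // subn0.
by rewrite addn0; case: eqP => _; rewrite ?subn0 // size_behead subn1.
Qed.

(** Induction from the right: a nonempty suffix of [rcons w x] is a suffix of [w] followed by [x],
    so the last letter merely shifts the allowed excess [c]. The one-letter suffix accounts for the
    extra condition that a final i+1 is always unmatched. *)
Lemma unm_leP i w c :
  reflect (forall p, count_mem i.+1 (drop p w) <= c + count_mem i (drop p w))
          (unm i w <= c).
Proof.
elim/last_ind: w c => [|w x IHw] c; first by rewrite unm_nil; apply: (iffP idP).
rewrite unm_rcons.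
have -> : (unm i w + (x == i.+1) - (x == i) <= c) =
    ((x == i.+1) <= c) && (unm i w <= c + (x == i) - (x == i.+1)).
  by apply/idP/idP; case: (x =P i) => [->|]; case: (x =P i.+1); lia.
have drop_rcons p : drop p (rcons w x) =
    if p <= size w then rcons (drop p w) x else [::].
  case: leqP => p_w; last by rewrite drop_oversize // size_rcons.
  by rewrite -!cats1 drop_cat; case: ltngtP p_w => // -> _;
    rewrite subnn drop_size.
apply: (iffP andP) => [[c_x /IHw le_w] p|le_w].
  rewrite drop_rcons; case: ifP => // _; move: (le_w p).
  by rewrite -!cats1 !count_cat /= !addn0; lia.
have := le_w (size w); rewrite drop_rcons leqnn drop_size /= !addn0 => le_x.
split; first by move: le_x; case: (x =P i) => [->|]; lia.
apply/IHw => p; have := le_w p; rewrite drop_rcons; case: (leqP p (size w)) => p_w.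
  by rewrite -!cats1 !count_cat /= !addn0; lia.
by rewrite drop_oversize // ltnW.
Qed.

(** In a sorted row every i precedes every i+1: the letters i close brackets left open by [w], then
    the letters i+1 are pushed and stay. *)
Lemma unm_cat_sorted i w r : sorted leq r ->
  unm i (w ++ r) = unm i w - count_mem i r + count_mem i.+1 r.
Proof.
elim/last_ind: r => [|r x IHr] sorted_r; first by rewrite cats0 subn0 addn0.
have sorted_r' : sorted leq r.
  by move: sorted_r; rewrite -cats1 => /cat_sorted2[].
rewrite -rcons_cat unm_rcons IHr // -cats1 !count_cat /= !addn0.
have [x_i|] := eqVneq x i; last by lia.
have le_r y : y \in r -> y <= i.
  move=> r_y; rewrite -x_i; move: sorted_r; rewrite -cats1.
  by rewrite (sorted_pairwise leq_trans) pairwise_cat allrel1r => /andP[/allP/(_ y r_y)].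
have -> : count_mem i.+1 r = 0.
  apply/count_memPn; apply/negP => /le_r; by rewrite ltnn.
by lia.
Qed.

(** A partial sum down column x of the matrix whose (r, x) entry is the multiplicity of the letter x
    in row r. *)
Definition colsum (t : tableau) (i x : nat) :=
  \sum_(0 <= r < i) count_mem x (nth [::] t r).

Lemma colsum_cons r t i x : colsum (r :: t) i.+1 x = count_mem x r + colsum t i x.
Proof. by rewrite /colsum big_nat_recl. Qed.

Lemma rword_cons r t : rword (r :: t) = rword t ++ r.
Proof. by rewrite /rword rev_cons flatten_rcons. Qed.

(** The reading word ends with the top row, so a suffix consists of some top rows and the end of the
    next one. The worst choice keeps the letters i+1 of that last row and none of its letters i;
    hence r+1 rows on one side and r on the other. *)
Lemma unm_rword_leP i t c : all (sorted leq) t ->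
  reflect (forall r, colsum t r.+1 i.+1 <= c + colsum t r i) (unm i (rword t) <= c).
Proof.
elim: t c => [|r t IHt] c /=.
  rewrite unm_nil => _; apply: (iffP idP) => // _ r.
  by rewrite /colsum big1 // => j _; rewrite nth_nil.
case/andP=> sorted_r sorted_t; rewrite rword_cons unm_cat_sorted //.
have -> : (unm i (rword t) - count_mem i r + count_mem i.+1 r <= c) =
   (count_mem i.+1 r <= c) && (unm i (rword t) <= c + count_mem i r - count_mem i.+1 r).
  by lia.
apply: (iffP andP) => [[le_c /IHt le_t] [|j]|le_t].
- by rewrite colsum_cons /colsum !big_geq // addn0 addn0.
- by have := le_t sorted_t j; rewrite !colsum_cons; lia.
have le_c : count_mem i.+1 r <= c.
  by have := le_t 0; rewrite colsum_cons /colsum !big_geq // !addn0.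
split=> //; apply/IHt => // j; have := le_t j.+1.
by rewrite !colsum_cons; lia.
Qed.

Lemma perm_rword t : perm_eq (rword t) (flatten t).
Proof.
elim: t => // r t IHt; rewrite rword_cons perm_catC perm_cat2l //.
Qed.

Lemma count_eps_ge i t : count_mem i.+1 (flatten t) <= eps i t + count_mem i (flatten t).
Proof.
rewrite epsE; have /unm_leP/(_ 0) := leqnn (unm i (rword t)).
by rewrite drop0 !(permP (perm_rword t)).
Qed.

(** * Tableaux and Littlewood-Richardson fillings *)

Lemma count_image (T1 T2 : eqType) (s1 : seq T1) (s2 : seq T2)
    (P1 : pred T1) (P2 : pred T2) (g : T2 -> T1) :
  uniq s1 -> uniq s2 ->
  (forall y, y \in s2 -> P2 y -> g y \in s1 /\ P1 (g y)) ->
  {in [pred y | y \in s2 & P2 y] &, injective g} ->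
  (forall x, x \in s1 -> P1 x -> exists y, [/\ y \in s2, P2 y & x = g y]) ->
  count P1 s1 = count P2 s2.
Proof.
move=> uniq1 uniq2 g_in g_inj g_onto; rewrite -!size_filter -(size_map g).
apply: perm_size; apply: uniq_perm; rewrite ?filter_uniq //.
  rewrite map_inj_in_uniq ?filter_uniq // => x y; rewrite !mem_filter => Px Py.
  by apply: g_inj; rewrite inE andbC.
move=> x; rewrite mem_filter; apply/andP/mapP => [[Px s_x]|[y]].
  by have [y [s_y Py ->]] := g_onto x s_x Px; exists y; rewrite ?mem_filter ?Py.
by rewrite mem_filter => /andP[Py s_y] ->; have [] := g_in y s_y Py.
Qed.

Lemma count_bij (T1 T2 : eqType) (s1 : seq T1) (s2 : seq T2)
    (P1 : pred T1) (P2 : pred T2) f g :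
  uniq s1 -> uniq s2 ->
  (forall x, x \in s1 -> P1 x -> [/\ f x \in s2, P2 (f x) & g (f x) = x]) ->
  (forall y, y \in s2 -> P2 y -> [/\ g y \in s1, P1 (g y) & f (g y) = y]) ->
  count P1 s1 = count P2 s2.
Proof.
move=> uniq1 uniq2 f_in g_in; apply: (@count_image _ _ _ _ _ _ g) => //.
- by move=> y s_y /(g_in y s_y)[].
- move=> y z /andP[/= s_y Py] /andP[/= s_z Pz] eq_g.
  by have [_ _ <-] := g_in y s_y Py; have [_ _ <-] := g_in z s_z Pz; rewrite eq_g.
by move=> x s_x /(f_in x s_x)[s_f P_f <-]; exists (f x).
Qed.

(** Taken over the rows of a semistandard tableau, these numbers are the entries of its
    Gelfand-Tsetlin pattern; column strictness becomes interlacing. *)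
Definition cntle (x : nat) (s : seq nat) := count (leq^~ x) s.

Lemma cntle_sum x s : all (leq 1) s ->
  cntle x s = \sum_(0 <= j < x) count_mem j.+1 s.
Proof.
move=> pos_s; elim: x => [|x IHx].
  rewrite big_geq // /cntle; elim: s pos_s => //= y s IHs /andP[y_gt0 /IHs ->].
  by rewrite leqn0 addn0 eqn0Ngt y_gt0.
rewrite big_nat_recr //= -IHx /cntle -count_predUI.
rewrite (@eq_count _ (predI _ _) pred0) ?count_pred0 ?addn0.
  by apply: eq_count => y /=; rewrite leq_eqVlt ltnS orbC.
by move=> y /=; case: (y =P x.+1) => [->|]; rewrite ?ltnn ?andbF.
Qed.

Lemma nth_leE s c x : sorted leq s -> c < size s ->
  (nth 0 s c <= x) = (c < cntle x s).
Proof.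
rewrite /cntle; elim: s c => // y s IHs c; rewrite /= (path_sortedE leq_trans).
case/andP=> /allP le_y sorted_s; have [le_yx|lt_xy] := leqP y x.
  by case: c => [|c] lt_c /=; rewrite ?le_yx // IHs.
have -> : count (leq^~ x) s = 0.
  apply/eqP; rewrite -leqn0 leqNgt -has_count; apply/hasPn => z /le_y le_yz.
  by rewrite -ltnNge (leq_trans lt_xy).
case: c => [|c] lt_c /=; first by rewrite leqNgt lt_xy.
by apply/negbTE; rewrite -ltnNge (leq_trans lt_xy) // le_y // mem_nth.
Qed.

(* a and b are the columns where the upper row R and the lower row S start. *)
Lemma col_strictP R S a b : sorted leq R -> sorted leq S -> all (leq 1) S ->
    b <= a -> b + size S <= a + size R ->
  reflect (forall x, b + cntle x.+1 S <= a + cntle x R)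
    (all (fun c => (a <= c) ==> (nth 0 R (c - a) < nth 0 S (c - b)))
         (iota b (size S))).
Proof.
move=> sorted_R sorted_S pos_S le_ba le_sz.
have le_R x : cntle x R <= size R by apply: count_size.
have le_S x : cntle x S <= size S by apply: count_size.
apply: (iffP allP) => [strict x|le_cnt c].
  (* [c] is the first column whose entry in the upper row exceeds x. If the inequality failed, the
     lower entry there would be at most x+1, against strictness. *)
  rewrite leqNgt; apply/negP => lt_x; pose c := a + cntle x R.
  have := strict c; rewrite mem_iota; have le_Sx := le_S x.+1; have le_Rx := le_R x.
  have [c_ge c_lt] : b <= c /\ c < b + size S by rewrite /c; lia.
  rewrite c_ge c_lt leq_addr addKn => /(_ isT)/= lt_RS.
  have c_S : c - b < size S by lia.
  have : c - b < cntle x.+1 S by rewrite /c; lia.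
  rewrite -nth_leE // => le_Sc; have le_Rc: nth 0 R (cntle x R) <= x by lia.
  have : cntle x R < size R by lia.
  by move/(nth_leE x sorted_R); rewrite le_Rc ltnn.
rewrite mem_iota => /andP[le_bc lt_c]; apply/implyP => le_ac.
have c_S : c - b < size S by lia.
(* The inequality is used at x, where x+1 is the entry of the lower row in column c. *)
have := allP pos_S _ (mem_nth 0 c_S); case def_x: nth => [|x] // _.
have : nth 0 S (c - b) <= x.+1 by rewrite def_x.
rewrite nth_leE // => lt_cnt; have := le_cnt x => le_x.
have lt_cR: c - a < cntle x R by lia.
by rewrite ltnS nth_leE //; have := le_R x; lia.
Qed.

Lemma part_nth_le s i j : is_part s -> i <= j -> nth 0 s j <= nth 0 s i.
Proof.
case/andP=> sorted_s _ le_ij; have [lt_j|] := ltnP j (size s); last first.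
  by move=> le_s; rewrite nth_default.
have geq_trans : transitive geq by move=> x y z /= le_xy le_zx; apply: leq_trans le_xy.
have := @sorted_leq_nth _ geq geq_trans leqnn 0 _ sorted_s i j.
by apply=> //; rewrite inE (leq_ltn_trans le_ij).
Qed.

Lemma part_nth_gt0 s i : is_part s -> (0 < nth 0 s i) = (i < size s).
Proof.
case/andP=> _ /allP pos_s; have [lt_i|le_i] := ltnP i (size s).
  by rewrite pos_s ?mem_nth.
by rewrite nth_default.
Qed.

(** Rows are numbered from 0 and letters from 1, whence the shifts. The letter 0 is invisible to
    this relation, so positivity of the entries is assumed separately below. *)
Definition dual (t u : tableau) :=
  forall i j, count_mem j.+1 (nth [::] t i) = count_mem i.+1 (nth [::] u j).

Lemma dual_sym t u : dual t u -> dual u t.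
Proof. by move=> dual_tu i j; rewrite dual_tu. Qed.

Definition row_pos (t : tableau) := all (all (leq 1)) t.
Definition row_sorted (t : tableau) := all (sorted leq) t.

Lemma all_nth_nil (P : pred (seq nat)) t i : P [::] -> all P t -> P (nth [::] t i).
Proof.
move=> P0 /allP Pt; have [lt_i|le_i] := ltnP i (size t); last by rewrite nth_default.
by rewrite Pt ?mem_nth.
Qed.

(** The dictionary between the two sides: it turns an inequality between [cntle] of consecutive
    rows, that is column strictness, into one between [colsum] of the dual, as produced by
    [unm_rword_leP]. *)
Lemma dual_cntle t u : dual t u -> row_pos t ->
  forall i x, cntle x (nth [::] t i) = colsum u x i.+1.
Proof.
move=> dual_tu pos_t i x; rewrite cntle_sum ?(@all_nth_nil (all (leq 1))) //.
by apply: eq_bigr => j _; rewrite dual_tu.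
Qed.

Lemma colsum_flatten t N x : size t <= N -> colsum t N x = count_mem x (flatten t).
Proof.
move=> le_N; rewrite count_flatten sumnE big_map /colsum (big_nth [::]).
rewrite (@big_cat_nat _ _ _ (size t)) //= [X in _ + X]big1_seq ?addn0 // => i.
by rewrite mem_index_iota => /andP[_ /andP[le_i _]]; rewrite nth_default.
Qed.

Lemma dual_row_size t u : dual t u -> row_pos t ->
  forall i, size (nth [::] t i) = count_mem i.+1 (flatten u).
Proof.
move=> dual_tu pos_t i.
(* Large enough that row i of [t] has only letters up to [N] and that the first [N] rows of [u] are
   all of [u]. *)
pose N := maxn (\max_(x <- nth [::] t i) x) (size u).
rewrite -(@colsum_flatten u N) ?leq_maxr // -(dual_cntle dual_tu pos_t).
rewrite /cntle; apply/esym/eqP; rewrite -all_count; apply/allP => x t_x.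
by rewrite leq_max (@leq_bigmax_seq _ _ _ id).
Qed.

Lemma dual_entries t u : dual t u -> forall i x, x \in nth [::] t i -> x <= size u.
Proof.
move=> dual_tu i [|x] //; rewrite -has_pred1 has_count dual_tu => t_x.
by rewrite ltnNge; apply/negP => le_x; rewrite nth_default in t_x.
Qed.

(** The number [l] of rows is a parameter because multiplicities do not detect trailing empty rows,
    which do occur in a filling of lambda/alpha where the two partitions agree. *)
Definition companion (l : nat) (u : tableau) : tableau :=
  mkseq (fun i => sort leq (flatten
    (mkseq (fun j => nseq (count_mem i.+1 (nth [::] u j)) j.+1) (size u)))) l.

Lemma count_mem_companion l u i j : i < l ->
  count_mem j.+1 (nth [::] (companion l u) i) = count_mem i.+1 (nth [::] u j).
Proof.
move=> lt_i; rewrite nth_mkseq // count_sort count_flatten sumnE !big_map.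
have [lt_j|le_j] := ltnP j (size u).
  rewrite (bigD1_seq j) ?mem_iota ?iota_uniq //= count_nseq /= eqxx mul1n.
  rewrite big1 ?addn0 // => j' neq_j; rewrite count_nseq /= eqSS.
  by rewrite (negPf neq_j).
rewrite [RHS]/= nth_default // big1_seq // => j'.
rewrite mem_iota count_nseq /= eqSS add0n => lt_j.
by case: eqP => //; lia.
Qed.

Lemma companion_row_pos l u : row_pos (companion l u).
Proof.
apply/allP => r /mapP[i _ ->]; rewrite all_sort; apply/allP => x.
by case/flattenP=> s /mapP[j _ ->] /nseqP[->].
Qed.

Lemma companion_row_sorted l u : row_sorted (companion l u).
Proof. by apply/allP => r /mapP[i _ ->]; apply: sort_sorted; apply: leq_total. Qed.

Lemma dual_companion l u : all (all (leq^~ l)) u -> dual (companion l u) u.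
Proof.
move=> le_u i j; have [lt_i|le_i] := ltnP i l; first exact: count_mem_companion.
rewrite nth_default ?size_mkseq //=; apply/esym/count_memPn/negP => u_i.
have := @all_nth_nil (all (leq^~ l)) u j isT le_u.
by move=> /allP/(_ _ u_i); lia.
Qed.

(** A sorted row is determined by the multiplicities of its letters, and positivity settles the
    letter 0. *)
Lemma dual_inj t t' u : dual t u -> dual t' u -> size t = size t' ->
  row_pos t -> row_pos t' -> row_sorted t -> row_sorted t' -> t = t'.
Proof.
move=> dual_t dual_t' eq_sz pos_t pos_t' sorted_t sorted_t'.
apply: (eq_from_nth (x0 := [::])) => // i _.
apply: (sorted_eq leq_trans anti_leq); try exact: (@all_nth_nil (sorted leq)).
apply/allP => -[|x] _ /=; last by rewrite dual_t dual_t'.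
have no0 s : all (leq 1) s -> count_mem 0 s = 0.
  by move=> /allP pos_s; apply/count_memPn/negP => /pos_s.
by rewrite !no0 ?(@all_nth_nil (all (leq 1))).
Qed.

Lemma nth_shape (t : tableau) i : nth 0 (shape t) i = size (nth [::] t i).
Proof.
have [lt_i|le_i] := ltnP i (size t); first by rewrite (nth_map [::]).
by rewrite !nth_default ?size_map.
Qed.

Lemma is_SSTP nu t : is_part nu ->
  reflect [/\ shape t = nu, row_pos t, row_sorted t &
    forall i x, cntle x.+1 (nth [::] t i.+1) <= cntle x (nth [::] t i)]
    (is_SST nu t).
Proof.
move=> part_nu; rewrite /is_SST.
have [shape_t|ne_nu] /= := eqVneq (shape t) nu; last by right=> -[/eqP]; rewrite (negPf ne_nu).
apply: (iffP and3P) => [[pos_t sorted_t strict]|[_ pos_t sorted_t strict]].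
  split=> // i; apply/(@col_strictP _ _ 0 0) => //;
    try exact: (@all_nth_nil (sorted leq)); try exact: (@all_nth_nil (all (leq 1))).
    by rewrite !add0n -!nth_shape shape_t part_nth_le.
  have [lt_i|le_i] := ltnP i (size t).-1; last by rewrite [nth _ t _.+1]nth_default //; lia.
  have := allP strict i; rewrite mem_iota => /(_ lt_i)/allP strict_i.
  by apply/allP => c c_i; rewrite subn0; apply: strict_i.
split=> //; apply/allP => i _; apply/allP => c c_i.
have := strict i => /(@col_strictP _ _ 0 0).
rewrite !add0n -!nth_shape shape_t part_nth_le //.
rewrite !(@all_nth_nil (sorted leq)) // (@all_nth_nil (all (leq 1))) //.
by move=> /(_ isT isT isT isT isT)/allP/(_ c); rewrite -shape_t nth_shape !subn0; apply.
Qed.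

(** The word read here is the reverse of [rword u], so its prefixes are reversed suffixes: the
    lattice condition says that all string lengths vanish, i.e. that [u] is of highest weight, and
    [unm_rword_leP] applies with c = 0. *)
Lemma latticeP u : row_sorted u ->
  reflect (forall i r, colsum u r.+1 i.+2 <= colsum u r i.+1)
          (lattice (flatten (map rev u))).
Proof.
move=> sorted_u; set w := flatten _.
have rev_w : rev w = rword u.
  by rewrite /w /rword; elim: (u) => //= r u' IHu; rewrite rev_cat IHu rev_cons flatten_rcons revK.
have drop_w p : drop p (rword u) = rev (take (size w - p) w).
  by rewrite -rev_w drop_rev.
have unm0 i : reflect (forall r, colsum u r.+1 i.+2 <= colsum u r i.+1) (unm i.+1 (rword u) <= 0).
  by apply: (iffP (unm_rword_leP i.+1 0 sorted_u)).
apply: (iffP allP) => [lat i|col_le p _]; last first.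
  apply/allP => i _; have /unm0/unm_leP/(_ (size w - p)) := col_le i.
  rewrite drop_w !count_rev add0n; have [le_p|lt_p] := leqP p (size w).
    by rewrite subKn.
  by rewrite (take_oversize (ltnW lt_p)) (take_oversize _) //; lia.
apply/unm0/unm_leP => p; rewrite drop_w !count_rev add0n.
set q := size w - p; have /lat/allP/(_ i) : q \in iota 0 (size w).+1.
  by rewrite mem_iota /q; lia.
rewrite mem_iota /=; have [lt_i|le_i] := ltnP i (\max_(x <- w) x); first by apply.
move=> _; suff /count_memPn-> : i.+2 \notin take q w by [].
apply/negP => /mem_take w_i; suff: i.+2 <= i by lia.
by apply: leq_trans le_i; apply: (@leq_bigmax_seq _ w xpredT id).
Qed.

(** * Littlewood-Richardson coefficients count crystal elements *)

Lemma all_flatten (T : Type) (P : pred T) (ss : seq (seq T)) :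
  all P (flatten ss) = all (all P) ss.
Proof. by elim: ss => //= s ss <-; rewrite all_cat. Qed.

Lemma leq_maxent t x : x \in flatten t -> x <= maxent t.
Proof. by move=> t_x; apply: (@leq_bigmax_seq _ _ xpredT id). Qed.

Lemma count_mem_gt_maxent t x : maxent t < x -> count_mem x (flatten t) = 0.
Proof. by move=> gt_x; apply/count_memPn/negP => /leq_maxent; lia. Qed.

Lemma eps_ge_maxent t i : maxent t <= i -> eps i t = 0.
Proof.
move=> ge_i; apply/eqP; rewrite -leqn0 epsE; apply/unm_leP => p.
suff /count_memPn-> : i.+1 \notin drop p (rword t) by [].
by apply/negP => /mem_drop; rewrite (perm_mem (perm_rword t)) => /leq_maxent; lia.
Qed.

Lemma epsv_sum t j N : maxent t < N ->
  epsv t j = (\sum_(j <= i < N) Posz (eps i t))%R.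
Proof.
move=> lt_N; rewrite /epsv; have [le_j|lt_j] := leqP j (maxent t).+1.
  rewrite [RHS](@big_cat_nat _ _ _ (maxent t).+1) //=.
  rewrite [X in _ = (_ + X)%R]big1_seq ?addr0 // => i.
  by rewrite mem_index_iota => /andP[_ /andP[lt_i _]]; rewrite eps_ge_maxent // ltnW.
rewrite big_geq 1?ltnW // big1_seq // => i; rewrite mem_index_iota.
by move=> /andP[_ /andP[lt_i _]]; rewrite eps_ge_maxent //; lia.
Qed.

Lemma omc_epsv t i : omc (epsv t) i = Posz (eps i t).
Proof.
rewrite /omc !(@epsv_sum _ _ (maxn (maxent t) i.+1).+1) ?ltnS ?leq_maxl //.
by rewrite [X in (X - _)%R]big_ltn ?addrK //; lia.
Qed.

Lemma omcB (x y : vec) i : omc (fun j => x j - y j)%R i = (omc x i - omc y i)%R.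
Proof. by rewrite /omc; lia. Qed.

Lemma leL_epsv t al : leL (epsv t) (pv al) <->
  (forall j, eps j.+1 t + nth 0 al j.+1 <= nth 0 al j).
Proof.
split=> le_al j; last case: j => // j _.
  by have := le_al j.+1 isT; rewrite omcB omc_epsv /omc /pv /=; lia.
by have := le_al j; rewrite omcB omc_epsv /omc /pv /=; lia.
Qed.

Lemma CLR_nat lam al nu t : CLR lam al nu t <->
  [/\ is_SST nu t, forall j, eps j.+1 t + nth 0 al j.+1 <= nth 0 al j
    & forall j, nth 0 al j + count_mem j.+1 (flatten t) = nth 0 lam j].
Proof.
split=> -[SST_t le_al wt_t]; split=> //; try exact/leL_epsv.
  by move=> j; have := wt_t j.+1 isT; rewrite /pv /wt /=; lia.
by case=> // j _; have := wt_t j; rewrite /pv /wt /=; lia.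
Qed.

(** Beyond the range [s] the letter counts, string lengths and parts are all zero, so finitely many
    coordinates decide. *)
Definition CLRb lam al nu t :=
  let s := iota 0 (maxent t + size al + size lam) in
  [&& is_SST nu t, all (fun j => eps j.+1 t + nth 0 al j.+1 <= nth 0 al j) s
    & all (fun j => nth 0 al j + count_mem j.+1 (flatten t) == nth 0 lam j) s].

Lemma CLRP lam al nu t : reflect (CLR lam al nu t) (CLRb lam al nu t).
Proof.
apply: (iffP and3P); rewrite CLR_nat => -[SST_t le_al wt_t]; split=> //.
- move=> j; have [lt_j|le_j] := ltnP j (maxent t + size al + size lam).
    by apply: (allP le_al); rewrite mem_iota.
  by rewrite eps_ge_maxent ?[nth _ _ j.+1]nth_default //; lia.
- move=> j; have [lt_j|le_j] := ltnP j (maxent t + size al + size lam).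
    by apply/eqP; apply: (allP wt_t); rewrite mem_iota.
  by rewrite count_mem_gt_maxent ?[nth _ _ j]nth_default //; lia.
- by apply/allP => j _.
by apply/allP => j _; rewrite wt_t.
Qed.

Lemma mem_prodseq (T : eqType) k (X s : seq T) :
  (s \in prodseq k X) = (size s == k) && all (mem X) s.
Proof.
elim: k s => [|k IHk] [|x s] //=.
  by apply/negP => /allpairsP[[? ?] [_ _]].
rewrite eqSS andbCA -IHk; apply/allpairsP/andP => [[[y u] [X_y u_in [-> ->]]]|[X_x s_in]] //.
by exists (x, s).
Qed.

Lemma uniq_prodseq (T : eqType) k (X : seq T) : uniq X -> uniq (prodseq k X).
Proof.
move=> uniqX; elim: k => //= k IHk; apply: allpairs_uniq => //.
by move=> [x s] [y u] _ _ /= [-> ->].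
Qed.

Definition SSTs N nu := [seq t <- [seq reshape nu w | w <- prodseq (sumn nu) (iota 1 N)] | is_SST nu t].

Lemma mem_SSTs N nu t :
  (t \in SSTs N nu) = is_SST nu t && all (leq^~ N) (flatten t).
Proof.
rewrite mem_filter; case SST_t: (is_SST nu t) => //=.
have [/eqP shape_t pos_t _ _] := and4P SST_t; change (seq.shape t = nu) in shape_t.
have {}pos_t : all (leq 1) (flatten t).
  by apply/allP => x /flattenP[r t_r]; apply: allP (allP pos_t r t_r) x.
apply/mapP/idP => [[w]|le_N].
  rewrite mem_prodseq => /andP[/eqP sz_w /allP w_in] ->.
  rewrite reshapeKr ?sz_w //; apply/allP => x /w_in.
  by rewrite inE mem_iota add1n ltnS => /andP[].
exists (flatten t); last by rewrite -shape_t flattenK.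
rewrite mem_prodseq size_flatten [seq.shape t]shape_t eqxx; apply/allP => x t_x.
by rewrite inE mem_iota add1n ltnS (allP le_N) // (allP pos_t).
Qed.

Lemma uniq_SSTs N nu : uniq (SSTs N nu).
Proof.
rewrite filter_uniq // map_inj_in_uniq ?uniq_prodseq ?iota_uniq // => w w'.
rewrite !mem_prodseq => /andP[/eqP sz_w _] /andP[/eqP sz_w' _] eq_ww'.
by rewrite -(@reshapeKr _ nu w) ?sz_w // eq_ww' reshapeKr ?sz_w'.
Qed.

Lemma sumn_nth s N : size s <= N -> sumn s = \sum_(0 <= j < N) nth 0 s j.
Proof.
move=> le_N; rewrite sumnE (big_nth 0) [RHS](@big_cat_nat _ _ _ (size s)) //=.
rewrite [X in _ + X]big1_seq ?addn0 // => i.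
by rewrite mem_index_iota => /andP[_ /andP[le_i _]]; rewrite nth_default.
Qed.

Definition skew_rows (lam al : seq nat) :=
  [seq nth 0 lam r - nth 0 al r | r <- iota 0 (size lam)].

Lemma subpartP al lam : reflect (size al <= size lam /\ forall r, nth 0 al r <= nth 0 lam r)
  (subpart al lam).
Proof.
apply: (iffP andP) => -[le_sz le_nth]; split=> //; last by apply/allP.
move=> r; have [lt_r|le_r] := ltnP r (size lam).
  by apply: (allP le_nth); rewrite mem_iota.
by rewrite nth_default // (leq_trans le_sz).
Qed.

Lemma sumn_skew_rows lam al : subpart al lam ->
  sumn (skew_rows lam al) = sumn lam - sumn al.
Proof.
case/subpartP=> le_sz le_nth; rewrite (sumn_nth le_sz) (sumn_nth (leqnn (size lam))).
by rewrite /skew_rows sumnE big_map /index_iota subn0 sumnB.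
Qed.

(** The conditions correspond one by one: content of [u] to shape of [t], row lengths of [u] to
    weight of [t], lattice condition of [u] to column strictness of [t]. Column strictness of [u]
    across rows j and j+1 and the bound on eps_(j+1) are both equivalent to the inequality displayed
    in [strictP] and [epsP]. *)
Lemma LRfill_dual lam al nu t u : is_part lam -> is_part al -> is_part nu ->
  subpart al lam -> dual t u -> size t = size nu -> shape u = skew_rows lam al ->
  row_pos t -> row_sorted t -> row_pos u -> row_sorted u ->
  LRfill lam al nu (flatten u) = CLRb lam al nu t.
Proof.
move=> part_lam part_al part_nu sub_al dual_tu sz_t shape_u pos_t sorted_t pos_u sorted_u.
have [le_sz le_al] := subpartP _ _ sub_al.
have dual_ut := dual_sym dual_tu.
have sz_u : size u = size lam by rewrite -(size_map size) -/(shape u) shape_u size_map size_iota.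
have sz_row r : size (nth [::] u r) = nth 0 lam r - nth 0 al r.
  rewrite -nth_shape shape_u /skew_rows; have [lt_r|le_r] := ltnP r (size lam).
    by rewrite (nth_map 0) ?size_iota // nth_iota.
  by rewrite !nth_default ?size_map ?size_iota // (leq_trans le_sz).
have wt_t j : nth 0 al j + count_mem j.+1 (flatten t) = nth 0 lam j.
  by rewrite -(dual_row_size dual_ut pos_u) sz_row subnKC.
have part_lam_le j : nth 0 lam j.+1 <= nth 0 lam j by apply: part_nth_le.
have strictP j : reflect
    (forall i, nth 0 al j.+1 + colsum t i.+1 j.+2 <= nth 0 al j + colsum t i j.+1)
    (all (fun c => (nth 0 al j <= c) ==> (nth 0 (nth [::] u j) (c - nth 0 al j) <
                       nth 0 (nth [::] u j.+1) (c - nth 0 al j.+1)))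
         (iota (nth 0 al j.+1) (nth 0 lam j.+1 - nth 0 al j.+1))).
  rewrite -sz_row; apply: (iffP (@col_strictP _ _ _ _ _ _ _ _ _)).
  - exact: (@all_nth_nil (sorted leq)).
  - exact: (@all_nth_nil (sorted leq)).
  - exact: (@all_nth_nil (all (leq 1))).
  - exact: part_nth_le.
  - by rewrite !sz_row !subnKC.
  - by move=> le_cnt i; have := le_cnt i; rewrite !(dual_cntle dual_ut pos_u).
  - by move=> le_cnt i; rewrite !(dual_cntle dual_ut pos_u).
have epsP j : reflect
    (forall i, nth 0 al j.+1 + colsum t i.+1 j.+2 <= nth 0 al j + colsum t i j.+1)
    (eps j.+1 t + nth 0 al j.+1 <= nth 0 al j).
  have le_al_j : nth 0 al j.+1 <= nth 0 al j by apply: part_nth_le.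
  have -> : (eps j.+1 t + nth 0 al j.+1 <= nth 0 al j) =
    (unm j.+1 (rword t) <= nth 0 al j - nth 0 al j.+1) by rewrite epsE; lia.
  apply: (iffP (unm_rword_leP _ _ sorted_t)) => le_col i; have := le_col i; lia.
rewrite /LRfill -/(skew_rows lam al) -shape_u flattenK size_flatten eqxx /=.
apply/idP/CLRP => [/and5P[_ _ strict content lat]|]; rewrite CLR_nat.
  split=> //.
    apply/is_SSTP => //; split=> //.
      apply: (@eq_from_nth _ 0); first by rewrite size_map.
      move=> i; rewrite size_map => lt_i; rewrite nth_shape (dual_row_size dual_tu) //.
      by rewrite -[in RHS](eqP content) (nth_map 0) ?size_iota ?nth_iota // -sz_t.
    by move=> i x; rewrite !(dual_cntle dual_tu pos_t); apply/latticeP.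
  move=> j; apply/epsP/strictP; have [lt_j|le_j] := ltnP j (size lam).-1.
    by apply: (allP strict); rewrite mem_iota.
  rewrite [nth 0 lam _]nth_default ?sub0n //; lia.
case=> /(is_SSTP _ part_nu)[shape_t _ _ strict] le_eps _.
apply/and5P; split=> //.
- apply/allP => x /flattenP[r u_r r_x].
  have [j lt_j def_r] := nthP [::] u_r; rewrite -def_r in r_x.
  rewrite -sz_t (dual_entries dual_ut r_x) andbT.
  by apply: (allP (allP pos_u _ u_r)); rewrite -def_r.
- by apply/allP => j _; apply/strictP/epsP.
- apply/eqP; apply: (@eq_from_nth _ 0); first by rewrite size_map size_iota.
  move=> i; rewrite size_map size_iota => lt_i; rewrite (nth_map 0) ?size_iota //.
  by rewrite nth_iota // -shape_t nth_shape (dual_row_size dual_tu).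
- by apply/latticeP => // i r; rewrite -!(dual_cntle dual_tu pos_t).
Qed.

(** The entries of the companion of a filling are row numbers of lambda, so entries up to [N]
    suffice once lambda has at most [N] parts. *)
Lemma LR_count N lam al nu : is_part lam -> is_part al -> is_part nu ->
  size lam <= N -> LR lam al nu = count (CLRb lam al nu) (SSTs N nu).
Proof.
move=> part_lam part_al part_nu le_N; rewrite /LR; case: ifP => [sub_al|nsub]; last first.
  (* If alpha is not contained in lambda, the weight equation alpha + wt(t) = lambda has no
     solution. *)
  apply/esym/eqP; rewrite -leqn0 leqNgt -has_count; apply/hasPn => t _.
  apply/negP => /CLRP/CLR_nat[_ _ wt_t]; case/negP: nsub; apply/subpartP.
  split=> [|r]; last by have := wt_t r; lia.
  rewrite leqNgt -part_nth_gt0 //; have := wt_t (size lam).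
  by rewrite [nth 0 lam _]nth_default //; lia.
have [le_sz le_al] := subpartP _ _ sub_al.
apply: (@count_bij _ _ _ _ _ _
  (fun w => companion (size nu) (reshape (skew_rows lam al) w))
  (fun t => flatten (companion (size lam) t))).
- exact/uniq_prodseq/iota_uniq.
- exact: uniq_SSTs.
- move=> w; rewrite mem_prodseq => /andP[/eqP sz_w _] fill_w.
  have [_ /allP w_in sorted_u _ _] := and5P fill_w.
  set u := reshape _ w.
  have flat_u : flatten u = w by rewrite reshapeKr // sz_w sumn_skew_rows.
  have shape_u : shape u = skew_rows lam al by rewrite reshapeKl // sz_w sumn_skew_rows.
  have sz_u : size u = size lam by rewrite size_reshape size_map size_iota.
  have pos_u : row_pos u.
    by rewrite /row_pos -all_flatten flat_u; apply/allP => x /w_in/andP[].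
  have le_u : all (all (leq^~ (size nu))) u.
    by rewrite -all_flatten flat_u; apply/allP => x /w_in/andP[].
  have dual_tu := dual_companion le_u.
  set t := companion _ u in dual_tu *.
  have pos_t : row_pos t := companion_row_pos _ _.
  have sorted_t : row_sorted t := companion_row_sorted _ _.
  have CLR_t : CLRb lam al nu t.
    by rewrite -(LRfill_dual part_lam part_al _ sub_al dual_tu) ?flat_u ?size_mkseq.
  split=> //.
    rewrite mem_SSTs; have /andP[-> _] /= := CLR_t.
    apply/allP => x /flattenP[r t_r r_x]; have [i lt_i def_r] := nthP [::] t_r.
    by rewrite (leq_trans _ le_N) // -sz_u (dual_entries dual_tu (i := i)) // def_r.
  have le_t : all (all (leq^~ (size lam))) t.
    apply/allP => r t_r; apply/allP => x r_x; have [i lt_i def_r] := nthP [::] t_r.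
    by rewrite -sz_u (dual_entries dual_tu (i := i)) // def_r.
  rewrite -flat_u; congr flatten.
  apply: (dual_inj (dual_companion le_t)); first exact: dual_sym.
  - by rewrite size_mkseq sz_u.
  - exact: companion_row_pos.
  - exact: pos_u.
  - exact: companion_row_sorted.
  - exact: sorted_u.
move=> t _ /[dup]/CLRP/CLR_nat[SST_t le_eps wt_t] CLR_t.
have [shape_t pos_t sorted_t _] := is_SSTP _ part_nu SST_t.
have sz_t : size t = size nu by rewrite -shape_t size_map.
have le_t : all (all (leq^~ (size lam))) t.
  rewrite -all_flatten; apply/allP => -[|x] // t_x; rewrite -part_nth_gt0 // -wt_t.
  by rewrite addn_gt0 orbC -has_count has_pred1 t_x.
have dual_tu := dual_sym (dual_companion le_t).
set u := companion _ t in dual_tu *.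
have pos_u : row_pos u := companion_row_pos _ _.
have sorted_u : row_sorted u := companion_row_sorted _ _.
have sz_u : size u = size lam by rewrite size_mkseq.
have shape_u : shape u = skew_rows lam al.
  apply: (@eq_from_nth _ 0); first by rewrite !size_map size_iota.
  move=> j; rewrite size_map sz_u => lt_j; rewrite nth_shape.
  rewrite (dual_row_size (dual_sym dual_tu)) // (nth_map 0) ?size_iota ?nth_iota //.
  by rewrite -wt_t addKn.
have fill_u : LRfill lam al nu (flatten u).
  by rewrite (LRfill_dual part_lam part_al part_nu sub_al dual_tu).
split=> //.
  rewrite mem_prodseq size_flatten shape_u sumn_skew_rows // eqxx.
  have [_ /allP u_in _ _ _] := and5P fill_u.
  by apply/allP => x /u_in; rewrite inE mem_iota add1n ltnS.
rewrite -shape_u flattenK; have le_u : all (all (leq^~ (size nu))) u.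
  apply/allP => r u_r; apply/allP => x r_x; have [i lt_i def_r] := nthP [::] u_r.
  by rewrite -sz_t (dual_entries (dual_sym dual_tu) (i := i)) // def_r.
apply: (dual_inj (dual_companion le_u)) => //.
- by rewrite size_mkseq sz_t.
- exact: companion_row_pos.
- exact: companion_row_sorted.
Qed.

(** * The pairs of k-tuples compatible with a fixed T *)

(** The zeros of a decreasing list are at its end, so deleting them moves no other entry. *)
Lemma filter_gt0_part s : sorted geq s ->
  is_part [seq n <- s | 0 < n] /\ forall j, nth 0 [seq n <- s | 0 < n] j = nth 0 s j.
Proof.
have geq_trans : transitive geq by move=> x y z /= le_xy le_zx; apply: leq_trans le_xy.
move=> sorted_s; rewrite /is_part filter_all andbT; split.
  exact: sorted_filter.
elim: s sorted_s => // x s IHs; rewrite /= (path_sortedE geq_trans).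
case/andP=> /allP le_x /IHs nth_s; have le_nth j : nth 0 s j <= x.
  have [lt_j|le_j] := ltnP j (size s); last by rewrite nth_default.
  exact: (le_x _ (mem_nth 0 lt_j)).
case: x le_nth {le_x} => [|x] le_nth [|j] //=; rewrite nth_s.
  by apply/eqP; rewrite -leqn0.
by have := le_nth j; have := le_nth j.+1; rewrite !leqn0 => /eqP-> /eqP->.
Qed.

(** A [vec] is an arbitrary function; the second clause restores the finite support of elements of
    Lambda. Without it a negative constant would have nonnegative omega-coordinates. *)
Definition dominant (N : nat) (x : vec) : Prop :=
  (forall i, 0 < i -> (0 <= omc x i)%R) /\ (forall j, N < j -> x j = 0%R).

Definition part_of_vec (N : nat) (x : vec) : seq nat :=
  [seq n <- mkseq (fun j => `|x j.+1|%N) N | 0 < n].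

Lemma dominant_ge0 N x : dominant N x -> forall j, 0 < j -> (0 <= x j)%R.
Proof.
case=> x_ge0 x_eq0 j; have [lt_j|le_j] := ltnP N j; first by rewrite x_eq0.
elim: {j}(N - j) {-2}j (erefl (N - j)) le_j => [|n IHn] j def_n le_j j_gt0.
  have -> : j = N by lia.
  by have := x_ge0 N; rewrite /omc (x_eq0 N.+1) // subr0; apply; lia.
have := x_ge0 j j_gt0; rewrite /omc subr_ge0; apply: le_trans.
by apply: IHn; lia.
Qed.

Lemma part_of_vecP N x : dominant N x ->
  is_part (part_of_vec N x) /\ forall j, 0 < j -> pv (part_of_vec N x) j = x j.
Proof.
move=> dom_x; have [x_ge0 x_eq0] := dom_x; have pos_x := dominant_ge0 dom_x.
have [|part_x nth_x] := @filter_gt0_part (mkseq (fun j => `|x j.+1|%N) N).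
  apply/(sortedP 0) => i; rewrite size_mkseq => lt_i.
  rewrite !nth_mkseq //; last exact: ltnW.
  by have := pos_x i.+1 isT; have := pos_x i.+2 isT; have := x_ge0 i.+1 isT; rewrite /omc /=; lia.
split=> // -[|j] // _; rewrite /pv nth_x; have [lt_j|le_j] := ltnP j N.
  by rewrite nth_mkseq // gez0_abs // pos_x.
by rewrite nth_default ?size_mkseq // x_eq0.
Qed.

Lemma pv_dominant s : is_part s -> dominant (size s) (pv s).
Proof.
move=> part_s; split=> -[|j] // lt_j; rewrite /omc /pv /=.
  by have := part_nth_le part_s (leqnSn j); lia.
by rewrite nth_default.
Qed.

Lemma pv_inj s1 s2 : is_part s1 -> is_part s2 ->
  (forall j, 0 < j -> pv s1 j = pv s2 j) -> s1 = s2.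
Proof.
move=> part1 part2 eq_pv.
have eq_nth j : nth 0 s1 j = nth 0 s2 j by have [] := eq_pv j.+1 isT.
apply: (@eq_from_nth _ 0) => //.
have le_sz a b : is_part a -> (forall j, nth 0 a j = nth 0 b j) -> size a <= size b.
  by move=> part_a eq_ab; rewrite leqNgt -(part_nth_gt0 _ part_a) eq_ab nth_default.
by apply/eqP; rewrite eqn_leq !le_sz.
Qed.

Lemma vsize_eq N M x : M <= N -> (forall j, M <= j -> x j = 0%R) -> vsize N x = vsize M x.
Proof.
move=> le_MN x0; have [M_gt0|] := posnP M.
  rewrite /vsize [RHS]big_geq ?M_gt0 // big1 // => j _; apply: x0; lia.
move=> M_gt0; rewrite /vsize (@big_cat_nat _ _ _ M) //= [X in (_ + X)%R]big1_seq ?addr0 // => j.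
by rewrite mem_index_iota => /andP[_ /andP[le_j _]]; apply: x0.
Qed.

Lemma vsize_pv N s : size s < N -> vsize N (pv s) = Posz (sumn s).
Proof.
case: N => // N lt_N; rewrite (sumn_nth (ltnSE lt_N)) /vsize big_add1 /=.
by rewrite (big_morph Posz PoszD (erefl _)).
Qed.

Lemma maxl_leP l c : 0 < size l -> (maxl l <= c)%R = all (fun x => x <= c)%R l.
Proof.
case: l => // x l _; elim: l x => [|y l IHl] x; first by rewrite /= andbT.
by have := IHl y; rewrite /= ge_max => ->.
Qed.

Lemma maxl_eq0 l : all (fun x => x == 0)%R l -> maxl l = 0%R.
Proof.
elim: l => //= x l IHl /andP[/eqP-> /IHl l0]; case: l l0 {IHl} => // y l ->.
by rewrite maxxx.
Qed.

Notation Tn T r := (nth ([::], [::]) T r).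

Lemma maxent_lt_bndT T r : maxent (Tn T r).1 < bndT T /\ maxent (Tn T r).2 < bndT T.
Proof.
rewrite /bndT !ltnS; have [lt_r|le_r] := ltnP r (size T); last first.
  by rewrite nth_default //= /maxent big_nil.
have le_max := @leq_bigmax_seq _ T xpredT (fun p => maxn (maxent p.1) (maxent p.2)) _ (mem_nth _ lt_r) isT.
by split; apply: leq_trans (le_max ([::], [::])); rewrite ?leq_maxl ?leq_maxr.
Qed.

Lemma wt_eq0 t j : maxent t < j -> wt t j = 0%R.
Proof. by move=> lt_j; rewrite /wt count_mem_gt_maxent. Qed.

Lemma epsv_eq0 t j : maxent t < j -> epsv t j = 0%R.
Proof. by move=> lt_j; rewrite /epsv big_geq. Qed.

(* The string length phi_i(t) = eps_i(t) + <wt t, alpha_i> is nonnegative. *)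
Lemma omc_wt_eps_ge0 t i : (0 <= omc (wt t) i + Posz (eps i t))%R.
Proof.
have le_cnt (a b e : nat) : a <= e + b -> (0 <= Posz b - Posz a + Posz e :> int)%R by lia.
exact: le_cnt (count_eps_ge i t).
Qed.

Lemma wtT_eq0 T r j : bndT T <= j -> wtT T r j = 0%R.
Proof.
move=> le_j; have [lt1 lt2] := maxent_lt_bndT T r.
by rewrite /wtT !wt_eq0 ?subr0 //; lia.
Qed.

Lemma cumw_eq0 T r j : bndT T <= j -> cumw T r j = 0%R.
Proof. by move=> le_j; rewrite /cumw big1 // => s _; rewrite wtT_eq0. Qed.

Lemma cumwS T r j : cumw T r.+1 j = (cumw T r j + wtT T r.+1 j)%R.
Proof. by rewrite /cumw big_nat_recr. Qed.

Lemma cumw0 T j : cumw T 0 j = 0%R.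
Proof. by rewrite /cumw big_geq. Qed.

Lemma omcSp T r i : omc (Sp T r) i =
  (Posz (eps i (Tn T r).1) + omc (wt (Tn T r).1) i - omc (cumw T r) i)%R.
Proof. by rewrite -omc_epsv /omc /Sp; lia. Qed.

Lemma omcSm T r i : omc (Sm T r) i =
  (Posz (eps i (Tn T r).2) + omc (wt (Tn T r).1) i - omc (cumw T r) i)%R.
Proof. by rewrite -omc_epsv /omc /Sm; lia. Qed.

Lemma omc_lmin T i : 0 < i -> omc (lmin T) i = maxl [seq omc V i | V <- Svecs T].
Proof.
move=> i_gt0; rewrite /omc /lmin; have [lt_i|le_i] := ltnP i (bndT T).
  by rewrite [X in (X - _)%R]big_ltn // addrK.
(* Beyond [bndT T] the sum defining [lmin] is empty; this agrees with the maximum because every S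
   vector vanishes there. *)
rewrite !big_geq ?subr0 ?(leqW le_i) //; apply/esym/maxl_eq0.
rewrite all_map all_flatten all_map; apply/allP => r _ /=.
have [lt1 lt2] := maxent_lt_bndT T r.
rewrite /omc /Sp /Sm !epsv_eq0 ?wt_eq0 ?cumw_eq0 ?subr0 ?addr0 //; lia.
Qed.

Lemma omc_lmin_leP T i c : 0 < i -> 0 < size T ->
  reflect (forall r, r < size T -> (omc (Sp T r) i <= c)%R /\ (omc (Sm T r) i <= c)%R)
    (omc (lmin T) i <= c)%R.
Proof.
move=> i_gt0 T_gt0; rewrite omc_lmin // maxl_leP; last by rewrite /Svecs; case: (T) T_gt0.
rewrite all_map all_flatten all_map.
apply: (iffP allP) => [le_c r lt_r|le_c r].
  by have := le_c r; rewrite mem_iota /= andbT => /(_ lt_r)/andP.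
by rewrite mem_iota /= andbT => /le_c/andP.
Qed.

Lemma lmin_eq0 T j : bndT T <= j -> lmin T j = 0%R.
Proof. by move=> le_j; rewrite /lmin big_geq. Qed.

Definition balanced (T : ttab) : Prop :=
  forall j, 0 < j -> (\sum_(0 <= s < size T) wtT T s j = 0)%R.

(** Closes the cycle: lambda_k computed from lambda_1 through T_2, ..., T_k is the predecessor
    required by T_1. *)
Lemma balanced_cumw T j : 0 < size T -> balanced T -> 0 < j ->
  (cumw T (size T).-1 j = - wtT T 0 j)%R.
Proof.
move=> T_gt0 bal_T /bal_T; rewrite big_ltn // /cumw prednK // => /eqP.
by rewrite addrC addr_eq0 => /eqP.
Qed.

Definition SST_tuple (nu : seq (seq nat * seq nat)) (T : ttab) : Prop :=
  size T = size nu /\ forall r, r < size nu ->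
    is_SST (Tn nu r).1 (Tn T r).1 /\ is_SST (Tn nu r).2 (Tn T r).2.

Definition CLRtuple (lam al : seq (seq nat)) (nu : seq (seq nat * seq nat)) (T : ttab) : Prop :=
  forall r, r < size nu ->
    CLR (nth [::] lam r) (nth [::] al r) (Tn nu r).1 (Tn T r).1 /\
    CLR (nth [::] lam (prevI (size nu) r)) (nth [::] al r) (Tn nu r).2 (Tn T r).2.

Definition shifted (T : ttab) (lam al : seq (seq nat)) (mu : seq nat) : Prop :=
  forall r j, r < size T -> 0 < j ->
    pv (nth [::] lam r) j = (lamT T r j + pv mu j)%R /\
    pv (nth [::] al r) j = (lamT T r j + pv mu j - wt (Tn T r).1 j)%R.

Lemma is_partk_nth k l r : is_partk k l -> is_part (nth [::] l r).
Proof.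
case/andP=> _ part_l; have [lt_r|le_r] := ltnP r (size l); last by rewrite nth_default.
by apply: (allP part_l); apply: mem_nth.
Qed.

(** Since alpha_r = lambda_min + [cumw] + mu - wt(T_r^+), the bound eps(T_r^+) <= alpha_r reads
    S_r^+ <= lambda_min + mu, and likewise for the minus sign. This is why wt(T_r^+) enters S_r^- as
    well. *)
Lemma shifted_CLRtuple nu T lam al mu : 0 < size nu -> SST_tuple nu T -> balanced T ->
  is_part mu -> shifted T lam al mu -> CLRtuple lam al nu T.
Proof.
move=> nu_gt0 [sz_T SST_T] bal_T part_mu sh r lt_r.
have [SST1 SST2] := SST_T r lt_r; rewrite -sz_T in lt_r nu_gt0 *.
have [mu_ge0 _] := pv_dominant part_mu.
have al_ge i : 0 < i -> omc (pv (nth [::] al r)) i =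
    (omc (lmin T) i + omc (cumw T r) i + omc (pv mu) i - omc (wt (Tn T r).1) i)%R.
  rewrite /omc; case: i => // i _.
  have [_ ->] := sh r i.+1 lt_r isT; have [_ ->] := sh r i.+2 lt_r isT.
  by rewrite /lamT; lia.
have lmin_ge i : 0 < i -> (omc (Sp T r) i <= omc (lmin T) i)%R /\ (omc (Sm T r) i <= omc (lmin T) i)%R.
  by move=> i_gt0; have /(omc_lmin_leP _ i_gt0 nu_gt0) := lexx (omc (lmin T) i); apply.
split; split=> //.
- move=> i i_gt0; rewrite omcB omc_epsv al_ge //.
  by have [] := lmin_ge i i_gt0; have := mu_ge0 i i_gt0; rewrite omcSp; lia.
- by move=> j j_gt0; have [-> ->] := sh r j lt_r j_gt0; rewrite subrK.
- move=> i i_gt0; rewrite omcB omc_epsv al_ge //.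
  by have [] := lmin_ge i i_gt0; have := mu_ge0 i i_gt0; rewrite omcSm; lia.
move=> j j_gt0; have [_ ->] := sh r j lt_r j_gt0.
have lt_p : prevI (size T) r < size T by case: (r) lt_r => /=; lia.
have [-> _] := sh _ j lt_p j_gt0; rewrite /lamT.
(* Only r = 0, whose predecessor is the last index, uses that [T] is balanced. *)
case: r lt_r {lt_p al_ge lmin_ge SST1 SST2} => [|r] lt_r /=.
  by rewrite balanced_cumw // cumw0 /wtT; lia.
by rewrite cumwS /wtT; lia.
Qed.

Lemma CLRtuple_shifted nu T lam al : 0 < size nu -> size T = size nu ->
  is_partk (size nu) lam -> CLRtuple lam al nu T ->
  [/\ SST_tuple nu T, balanced T & exists mu, is_part mu /\ shifted T lam al mu].
Proof.
move=> nu_gt0 sz_T part_lam clr.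
have al_lam r j : r < size T -> 0 < j ->
    (pv (nth [::] al r) j + wt (Tn T r).1 j = pv (nth [::] lam r) j)%R /\
    (pv (nth [::] al r) j + wt (Tn T r).2 j = pv (nth [::] lam (prevI (size T) r)) j)%R.
  rewrite sz_T => lt_r j_gt0; have [[_ _ wt1] [_ _ wt2]] := clr r lt_r.
  by rewrite wt1 ?wt2.
have lamE r j : r < size T -> 0 < j ->
    pv (nth [::] lam r) j = (pv (nth [::] lam 0) j + cumw T r j)%R.
  move=> lt_r j_gt0; elim: r lt_r => [|r IHr] lt_r; first by rewrite cumw0 addr0.
  have := al_lam r.+1 j lt_r j_gt0; rewrite cumwS /= IHr ?(ltnW lt_r) // /wtT; lia.
split.
- by split=> // r /clr[[? _ _] [? _ _]].
- move=> j j_gt0; have T_gt0 : 0 < size T by rewrite sz_T.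
  rewrite big_ltn // -[size T]prednK // -/(cumw T (size T).-1 j).
  have := al_lam 0 j T_gt0 j_gt0; rewrite /= (lamE (size T).-1) ?prednK // /wtT.
  by set c := cumw _ _ _ => -[]; lia.
(* The candidate for mu. Its omega-coordinates are nonnegative because lambda_1 dominates every S
   vector. *)
pose x : vec := fun j => (pv (nth [::] lam 0) j - lmin T j)%R.
pose N := maxn (bndT T) (size (nth [::] lam 0)).
have [_ lam0_eq0] := pv_dominant (is_partk_nth 0 part_lam).
have dom_x : dominant N x.
  split=> [i i_gt0|j lt_j]; last first.
    by rewrite /x lam0_eq0 ?lmin_eq0 ?subr0 //; move: lt_j; rewrite /N; lia.
  rewrite omcB subr_ge0; apply/omc_lmin_leP; rewrite ?sz_T // => r lt_r.
  have [[_ leL1 _] [_ leL2 _]] := clr r lt_r.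
  rewrite omcSp omcSm; have := leL1 i i_gt0; have := leL2 i i_gt0; rewrite !omcB !omc_epsv.
  rewrite -sz_T in lt_r; rewrite /omc.
  have := lamE r i lt_r i_gt0; have := lamE r i.+1 lt_r isT.
  have [] := al_lam r i lt_r i_gt0; have [] := al_lam r i.+1 lt_r isT; lia.
have [part_mu mu_x] := part_of_vecP dom_x.
exists (part_of_vec N x); split=> // r j lt_r j_gt0.
rewrite mu_x // /x /lamT; have [] := al_lam r j lt_r j_gt0.
have := lamE r j lt_r j_gt0; lia.
Qed.

Definition shift_bound (T : ttab) (mu : seq nat) := maxn (bndT T) (size mu).
Definition shift_lam (T : ttab) (mu : seq nat) :=
  mkseq (fun r => part_of_vec (shift_bound T mu) (fun j => lamT T r j + pv mu j)%R) (size T).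
Definition shift_al (T : ttab) (mu : seq nat) :=
  mkseq (fun r => part_of_vec (shift_bound T mu)
     (fun j => lamT T r j + pv mu j - wt (Tn T r).1 j)%R) (size T).

(** Dominance follows from S_r^+ <= lambda_min: the omega-coordinates of alpha_r are at least
    eps_i(T_r^+), and those of lambda_r at least phi_i(T_r^+), both nonnegative. With mu empty this
    shows that the lambda_i(T) are partitions. *)
Lemma shiftP T mu : is_part mu ->
  [/\ is_partk (size T) (shift_lam T mu), is_partk (size T) (shift_al T mu)
    & shifted T (shift_lam T mu) (shift_al T mu) mu].
Proof.
move=> part_mu; have [mu_ge0 mu_eq0] := pv_dominant part_mu.
have eq0 r j : shift_bound T mu < j -> (lamT T r j + pv mu j = 0)%R.
  by move=> lt_j; rewrite /lamT lmin_eq0 ?cumw_eq0 ?mu_eq0 //; move: lt_j; rewrite /shift_bound; lia.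
have omc_ge r i : r < size T -> 0 < i ->
    (omc (wt (Tn T r).1) i + Posz (eps i (Tn T r).1) <= omc (fun j => lamT T r j + pv mu j) i)%R.
  move=> lt_r i_gt0; have T_gt0 : 0 < size T by lia.
  have /(omc_lmin_leP _ i_gt0 T_gt0)/(_ r lt_r)[+ _] := lexx (omc (lmin T) i).
  by rewrite omcSp; have := mu_ge0 i i_gt0; rewrite /omc /lamT; lia.
have dom1 r : r < size T -> dominant (shift_bound T mu) (fun j => lamT T r j + pv mu j)%R.
  move=> lt_r; split=> [i i_gt0|j]; last exact: eq0.
  apply: le_trans (omc_ge r i lt_r i_gt0).
  exact: omc_wt_eps_ge0.
have dom2 r : r < size T -> dominant (shift_bound T mu)
    (fun j => lamT T r j + pv mu j - wt (Tn T r).1 j)%R.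
  move=> lt_r; split=> [i i_gt0|j lt_j].
    by rewrite omcB; have := omc_ge r i lt_r i_gt0; lia.
  rewrite eq0 // wt_eq0 ?subr0 //; have [lt1 _] := maxent_lt_bndT T r.
  by move: lt_j; rewrite /shift_bound; lia.
have part_mkseq f : (forall r, r < size T -> dominant (shift_bound T mu) (f r)) ->
    is_partk (size T) (mkseq (fun r => part_of_vec (shift_bound T mu) (f r)) (size T)).
  move=> dom_f; rewrite /is_partk size_mkseq eqxx; apply/allP => s /mapP[r].
  by rewrite mem_iota => lt_r ->; have [] := part_of_vecP (dom_f r lt_r).
split; [exact: part_mkseq | exact: part_mkseq | move=> r j lt_r j_gt0].
rewrite !nth_mkseq //; have [_ ->] := part_of_vecP (dom1 r lt_r); rewrite ?j_gt0 //.
by have [_ ->] := part_of_vecP (dom2 r lt_r).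
Qed.

Lemma sum_sumn_shifted T lam al mu : is_partk (size T) lam -> is_part mu ->
  shifted T lam al mu ->
  (Posz (\sum_(l <- lam) sumn l)%N = expo T + Posz (size T * sumn mu)%N)%R.
Proof.
move=> part_lam part_mu sh; have [/eqP sz_lam _] := andP part_lam.
rewrite (big_nth [::]) sz_lam big_mkord (big_morph Posz PoszD (erefl _)).
have -> : (Posz (size T * sumn mu)%N = \sum_(r < size T) Posz (sumn mu))%R.
  by rewrite sumr_const card_ord -mulr_natl PoszM natz.
rewrite -big_split; apply: eq_bigr => r _ /=.
(* A common bound for all supports involved, so that the three box counts are sums over the same
   range. *)
pose N := maxn (bndT T) (maxn (size mu) (size (nth [::] lam r))).+1.
rewrite -!(@vsize_pv N) ?/N; try lia.
rewrite -(@vsize_eq N (bndT T) (lamT T r)) ?leq_maxl //; last first.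
  by move=> j le_j; rewrite /lamT lmin_eq0 ?cumw_eq0.
rewrite /vsize -big_split; apply: eq_big_nat => j /andP[j_gt0 _].
by have [-> _] := sh r j (ltn_ord r) j_gt0.
Qed.

(** For the converse, mu empty provides the witnesses lambda_i(T). *)
Lemma distinguishedP nu T : 0 < size nu ->
  distinguished (size nu) nu T <-> SST_tuple nu T /\ balanced T.
Proof.
move=> nu_gt0; split=> [[sz_T [lam [al [part_lam _ clr]]]]|[SST_T bal_T]].
  by have [] := CLRtuple_shifted nu_gt0 sz_T part_lam clr.
have [sz_T _] := SST_T; split=> //; have [part_lam part_al sh] := @shiftP T [::] isT.
exists (shift_lam T [::]), (shift_al T [::]); rewrite -sz_T; split=> //.
by rewrite sz_T; apply: shifted_CLRtuple sh.
Qed.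

Lemma expo_ge0 T : (0 <= expo T)%R.
Proof.
have [part_lam _ sh] := @shiftP T [::] isT.
by have := sum_sumn_shifted (mu := [::]) part_lam isT sh; rewrite muln0 addr0 => <-.
Qed.

(** * Partitions and the Euler product *)

Lemma mem_seqs b l s :
  (s \in seqs b l) = (size s <= l) && all (fun x => 0 < x <= b) s.
Proof.
elim: l s => [|l IHl] [|x s] //=; rewrite inE /= ltnS andbCA -IHl.
apply/allpairsP/andP => [[[y u] [y_in u_in [-> ->]]]|[x_in s_in]].
  by split=> //; move: y_in; rewrite mem_iota add1n ltnS.
by exists (x, s); rewrite mem_iota add1n ltnS.
Qed.

Lemma size_part_le s : is_part s -> size s <= sumn s.
Proof.
case/andP=> _; elim: s => //= x s IHs /andP[x_gt0 /IHs]; lia.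
Qed.

Lemma mem_leq_sumn s x : x \in s -> x <= sumn s.
Proof.
elim: s => //= y s IHs; rewrite inE => /orP[/eqP->|/IHs]; first exact: leq_addr.
by move=> le_x; apply: leq_trans le_x (leq_addl _ _).
Qed.

Lemma mem_parts m s : (s \in parts m) = is_part s && (sumn s == m).
Proof.
rewrite mem_undup mem_filter mem_seqs.
case def_P: (is_part s && _) => //=; have /andP[part_s /eqP<-] := def_P.
rewrite size_part_le //; apply/allP => x s_x; rewrite mem_leq_sumn // andbT.
by have /andP[_ /allP] := part_s; apply.
Qed.

Lemma uniq_parts m : uniq (parts m). Proof. exact: undup_uniq. Qed.

Lemma mem_partsle n s : (s \in partsle n) = is_part s && (sumn s <= n).
Proof.
apply/flattenP/andP => [[l /mapP[m m_in ->]]|[part_s le_s]].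
  by rewrite mem_parts => /andP[-> /eqP->]; move: m_in; rewrite mem_iota ltnS.
exists (parts (sumn s)); last by rewrite mem_parts part_s eqxx.
by apply: map_f; rewrite mem_iota ltnS.
Qed.

Lemma uniq_partsle n : uniq (partsle n).
Proof.
rewrite /partsle; elim: (iota _ _) (iota_uniq 0 n.+1) => //= m l IHl /andP[m_l /IHl uniq_l].
rewrite cat_uniq uniq_parts uniq_l andbT /=; apply/hasPn => s /flattenP[p /mapP[c c_l ->]].
rewrite !mem_parts => /andP[_ /eqP->]; rewrite negb_and orbC.
by apply/orP; left; apply: contraNneq m_l => <-.
Qed.

Definition num_parts (b m : nat) := count (all (leq^~ b)) (parts m).

Lemma num_parts0 m : num_parts 0 m = (m == 0).
Proof.
rewrite /num_parts (@eq_in_count _ _ (pred1 [::])).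
  by rewrite count_uniq_mem ?uniq_parts // mem_parts /= eq_sym.
move=> [|x s] //; rewrite mem_parts /= => /andP[/andP[_ /= /andP[x_gt0 _]] _].
by rewrite leqNgt x_gt0.
Qed.

Lemma is_part_cons x s : is_part (x :: s) = [&& 0 < x, all (leq^~ x) s & is_part s].
Proof.
have geq_trans : transitive geq by move=> y z t /= le_zy le_tz; apply: leq_trans le_zy.
rewrite /is_part /= (path_sortedE geq_trans) -!andbA; do !bool_congr.
Qed.

Lemma count_predID (T : Type) (P Q : pred T) s :
  count P s = count (predI P Q) s + count (predI P (predC Q)) s.
Proof. by elim: s => //= x s ->; case: (P x); case: (Q x) => /=; lia. Qed.

(** Split by whether the largest part equals b+1; if so, remove it, which requires b+1 <= m. *)
Lemma num_partsS b m : num_parts b.+1 m =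
  num_parts b m + (if b < m then num_parts b.+1 (m - b.+1) else 0).
Proof.
rewrite /num_parts (@count_predID _ _ (fun s => head 0 s != b.+1)); congr (_ + _).
  apply: eq_in_count => -[|x s] //; rewrite mem_parts is_part_cons /=.
  case/andP=> /and3P[_ /allP le_x _] _.
  have le_s c : x <= c -> all (leq^~ c) s.
    by move=> le_xc; apply/allP => y /le_x /leq_trans; apply.
  have [le_xb|lt_bx] := leqP x b; first by rewrite !le_s ?(leqW le_xb) // ltn_eqF.
  case: (x =P b.+1) => [->|ne_x]; first by rewrite andbF.
  by rewrite [x <= b.+1]leqNgt (_ : b.+1 < x) //; lia.
case: ltnP => [lt_bm|le_mb].
  apply: (@count_bij _ _ _ _ _ _ behead (cons b.+1)); try exact: uniq_parts.
    move=> [|x s] //; rewrite !mem_parts is_part_cons /=.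
    case/andP=> /and3P[_ le_x part_s] /eqP<- /andP[/andP[_ le_b] /negbNE/eqP->].
    by split; rewrite ?part_s ?addKn ?eqxx.
  move=> s; rewrite !mem_parts is_part_cons /= => /andP[part_s /eqP sum_s] le_b.
  by split; rewrite ?part_s ?le_b ?sum_s ?subnKC ?eqxx ?leqnn.
apply/eqP; rewrite -leqn0 leqNgt -has_count; apply/hasPn => -[|x s]; rewrite mem_parts //=.
by case/andP=> _ /eqP def_m; rewrite negb_and negbK; case: eqP => [def_x|]; rewrite ?orbT //; lia.
Qed.

Lemma num_parts_all b m : m <= b -> num_parts b m = size (parts m).
Proof.
move=> le_mb; rewrite /num_parts; apply/eqP; rewrite -all_count; apply/allP => s.
rewrite mem_parts => /andP[_ /eqP sum_s]; apply/allP => x /mem_leq_sumn.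
by rewrite sum_s => /leq_trans; apply.
Qed.

Section EulerProduct.
Local Open Scope ring_scope.

Definition euler_prod (k n : nat) : {poly int} := \prod_(1 <= i < n.+1) (1 - 'X^(k * i)).

(** The coefficient of q^i in the inverse of the product of 1 - q^(k j) over 1 <= j <= b. *)
Definition scaled_num_parts (k b i : nat) : int :=
  if (k %| i)%N then Posz (num_parts b (i %/ k)) else 0.

Lemma coef_mul1Xn (p : {poly int}) a i :
  ((1 - 'X^a) * p)`_i = p`_i - (if (i < a)%N then 0 else p`_(i - a)).
Proof. by rewrite mulrBl mul1r coefB coefXnM. Qed.

Lemma euler_prodS k n : euler_prod k n.+1 = euler_prod k n * (1 - 'X^(k * n.+1)).
Proof. by rewrite /euler_prod big_nat_recr. Qed.

(** [Pcoef] truncates the product at its own index, whereas a convolution needs one polynomial for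
    all coefficients. Factors with i > j only affect degrees k i > j. *)
Lemma Pcoef_euler_prod k j n : (0 < k)%N -> (j <= n)%N -> Pcoef k j = (euler_prod k n)`_j.
Proof.
move=> k_gt0; elim: n => [|n IHn]; first by rewrite leqn0 => /eqP->.
rewrite leq_eqVlt ltnS => /orP[/eqP->//|le_jn].
rewrite euler_prodS mulrC coef_mul1Xn -IHn // ifT ?subr0 //.
by rewrite (@leq_trans n.+1) // leq_pmull.
Qed.

Lemma scaled_num_partsS k b i : (0 < k)%N ->
  scaled_num_parts k b.+1 i - (if (i < k * b.+1)%N then 0 else scaled_num_parts k b.+1 (i - k * b.+1)) =
  scaled_num_parts k b i.
Proof.
move=> k_gt0; rewrite /scaled_num_parts; have [/dvdnP[c ->]|ndvd] := boolP (k %| i)%N.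
  rewrite mulnK // (mulnC k) ltn_pmul2r // -mulnBl dvdn_mull // mulnK // num_partsS.
  by rewrite ltnNge leqNgt negbK ltnS; case: leqP => _; lia.
case: ltnP => [|le_i]; first by rewrite subrr.
by rewrite dvdn_subl ?dvdn_mulr // (negPf ndvd) subrr.
Qed.

(** The factor 1 - X^(k(n+1)) cancels the parts of size n+1, by [scaled_num_partsS], and reduces n+1
    to n. Truncating the series at [M] does not affect degrees below [M]. *)
Lemma euler_prod_num_parts k n M s : (0 < k)%N -> (s < M)%N ->
  (euler_prod k n * \poly_(i < M) scaled_num_parts k n i)`_s = (s == 0)%N%:R.
Proof.
move=> k_gt0; elim: n s => [|n IHn] s lt_s.
  rewrite /euler_prod big_geq // mul1r coef_poly lt_s /scaled_num_parts num_parts0.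
  case: (posnP s) => [->|s_gt0]; first by rewrite dvdn0 div0n.
  case: ifP => // /dvdnP[c def_s].
  by rewrite def_s mulnK // gtn_eqF //; case: c def_s s_gt0 => // ->.
rewrite euler_prodS -mulrA -(IHn s lt_s) !coefM; apply: eq_bigr => j _; congr (_ * _).
rewrite coef_mul1Xn !coef_poly (leq_ltn_trans (leq_subr _ _) lt_s).
rewrite -(@scaled_num_partsS k n (s - j)) //; congr (_ - _); case: ifP => // _.
by rewrite (leq_ltn_trans (leq_subr _ _)) ?(leq_ltn_trans (leq_subr _ _) lt_s).
Qed.

Definition scaled_parts (k i : nat) : int :=
  if (k %| i)%N then Posz (size (parts (i %/ k))) else 0.

(** Up to degree s, bounding the parts by s is no restriction, so the finite product inverts the
    full partition series. *)
Lemma euler_inverse k s : (0 < k)%N ->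
  \sum_(0 <= j < s.+1) Pcoef k j * scaled_parts k (s - j) = (s == 0)%N%:R.
Proof.
move=> k_gt0; rewrite -(@euler_prod_num_parts k s s.+1) // coefM big_mkord.
apply: eq_bigr => j _; rewrite (Pcoef_euler_prod k_gt0 (ltnSE (ltn_ord j))).
congr (_ * _); rewrite coef_poly ltnS leq_subr /scaled_parts /scaled_num_parts.
by case: ifP => // _; rewrite num_parts_all // (leq_trans (leq_div _ _)) // leq_subr.
Qed.

End EulerProduct.

(** * Counting over all T *)

Definition list_prod (T : Type) (Ls : seq (seq T)) : seq (seq T) :=
  foldr (fun L acc => [seq x :: t | x <- L, t <- acc]) [:: [::]] Ls.

Lemma all_iota0S (P : pred nat) n :
  all P (iota 0 n.+1) = P 0 && all (fun i => P i.+1) (iota 0 n).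
Proof. by rewrite /= -[1]addn0 iotaDl all_map. Qed.

Lemma mem_list_prod (T : eqType) (x0 : T) Ls s :
  (s \in list_prod Ls) =
  (size s == size Ls) && all (fun i => nth x0 s i \in nth [::] Ls i) (iota 0 (size Ls)).
Proof.
elim: Ls s => [|L Ls IHLs] [|x s] //.
  by apply/negP => /allpairsP[[? ?] [_ _]].
rewrite all_iota0S /= eqSS andbCA -IHLs.
apply/allpairsP/andP => [[[y u] [L_y u_in [-> ->]]]|[L_x s_in]] //.
by exists (x, s).
Qed.

Lemma uniq_list_prod (T : eqType) (Ls : seq (seq T)) : all uniq Ls -> uniq (list_prod Ls).
Proof.
elim: Ls => //= L Ls IHLs /andP[uniq_L /IHLs uniq_Ls]; apply: allpairs_uniq => //.
by move=> [x s] [y u] _ _ /= [-> ->].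
Qed.

Lemma count_allpairs (S T R : Type) (f : S -> T -> R) (P : pred S) (Q : pred T) (U : pred R) s t :
  (forall x y, U (f x y) = P x && Q y) ->
  count U [seq f x y | x <- s, y <- t] = count P s * count Q t.
Proof.
move=> UE; elim: s => //= x s IHs; rewrite count_cat IHs count_map mulnDl.
rewrite (@eq_count _ _ (fun y => P x && Q y)) => [|y]; last exact: UE.
by case: (P x); rewrite /= ?mul1n // count_pred0.
Qed.

Lemma count_list_prod (T : Type) (x0 : T) (P : nat -> pred T) Ls :
  count (fun s => all (fun i => P i (nth x0 s i)) (iota 0 (size Ls))) (list_prod Ls) =
  \prod_(i < size Ls) count (P i) (nth [::] Ls i).
Proof.
elim: Ls P => [|L Ls IHLs] P; first by rewrite big_ord0.
rewrite big_ord_recl /= -(IHLs (fun i => P i.+1)).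
by apply: count_allpairs => x s; exact: (all_iota0S (fun i => P i (nth x0 (x :: s) i))).
Qed.

(** A finite stand-in for the set of all T; the entry bound [N] loses nothing in degrees up to
    [N]. *)
Definition ttabs (N : nat) (nu : seq (seq nat * seq nat)) : seq ttab :=
  list_prod [seq [seq (a, b) | a <- SSTs N p.1, b <- SSTs N p.2] | p <- nu].

Lemma uniq_ttabs N nu : uniq (ttabs N nu).
Proof.
apply/uniq_list_prod/allP => L /mapP[p _ ->]; apply: allpairs_uniq; rewrite ?uniq_SSTs //.
by move=> [a b] [c d] _ _ /= [-> ->].
Qed.

Lemma mem_allpairs_pair (S T : eqType) (s : seq S) (t : seq T) p :
  (p \in [seq (a, b) | a <- s, b <- t]) = (p.1 \in s) && (p.2 \in t).
Proof.
apply/allpairsP/andP => [[[a b] [s_a t_b ->]] //|[s_p t_p]].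
by exists p; split=> //; case: p {s_p t_p}.
Qed.

Lemma mem_ttabs N nu T : reflect
  (SST_tuple nu T /\ forall r, r < size nu ->
     all (leq^~ N) (flatten (Tn T r).1) && all (leq^~ N) (flatten (Tn T r).2))
  (T \in ttabs N nu).
Proof.
rewrite (@mem_list_prod _ ([::], [::])) size_map.
apply: (iffP andP) => [[/eqP sz_T /allP T_in]|[[sz_T SST_T] le_N]]; last first.
  rewrite sz_T eqxx; split=> //; apply/allP => r; rewrite mem_iota => lt_r.
  rewrite (nth_map ([::], [::])) // mem_allpairs_pair !mem_SSTs.
  by have [-> ->] := SST_T r lt_r; have /andP[-> ->] := le_N r lt_r.
split; first split=> //.
all: move=> r lt_r; have := T_in r; rewrite mem_iota (nth_map ([::], [::])) // => /(_ lt_r).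
all: rewrite mem_allpairs_pair !mem_SSTs => /andP[/andP[? ?] /andP[? ?]].
  by split.
exact/andP.
Qed.

Definition CLRtupleb lam al nu T :=
  all (fun r => CLRb (nth [::] lam r) (nth [::] al r) (Tn nu r).1 (Tn T r).1 &&
    CLRb (nth [::] lam (prevI (size nu) r)) (nth [::] al r) (Tn nu r).2 (Tn T r).2)
  (iota 0 (size nu)).

Lemma CLRtupleP lam al nu T : reflect (CLRtuple lam al nu T) (CLRtupleb lam al nu T).
Proof.
apply: (iffP allP) => clr r; last first.
  by rewrite mem_iota => lt_r; have [/CLRP-> /CLRP->] := clr r lt_r.
move=> lt_r; have := clr r; rewrite mem_iota => /(_ lt_r)/andP.
by case=> /CLRP clr1 /CLRP clr2.
Qed.

Lemma prod_LR N lam al nu : all (fun p => is_part p.1 && is_part p.2) nu ->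
    is_partk (size nu) lam -> is_partk (size nu) al ->
    (forall r, size (nth [::] lam r) <= N) ->
  (\prod_(r < size nu)
    Posz ((LR (nth [::] lam r) (nth [::] al r) (Tn nu r).1
        * LR (nth [::] lam (prevI (size nu) r)) (nth [::] al r) (Tn nu r).2)%N))%R =
  Posz (count (CLRtupleb lam al nu) (ttabs N nu)).
Proof.
move=> /allP part_nu part_lam part_al le_N.
rewrite -(big_morph Posz PoszM (erefl _)); congr Posz.
have := @count_list_prod _ ([::], [::]) (fun r p =>
    CLRb (nth [::] lam r) (nth [::] al r) (Tn nu r).1 p.1 &&
    CLRb (nth [::] lam (prevI (size nu) r)) (nth [::] al r) (Tn nu r).2 p.2)
  [seq [seq (a, b) | a <- SSTs N p.1, b <- SSTs N p.2] | p <- nu].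
rewrite size_map => ->; apply: eq_bigr => r _.
have /andP[part1 part2] := part_nu _ (mem_nth ([::], [::]) (ltn_ord r)).
rewrite (nth_map ([::], [::])) //.
rewrite (@count_allpairs _ _ _ _ (CLRb (nth [::] lam r) (nth [::] al r) (Tn nu r).1)
  (CLRb (nth [::] lam (prevI (size nu) r)) (nth [::] al r) (Tn nu r).2)) //.
by rewrite -!LR_count //; apply: is_partk_nth part_lam || apply: is_partk_nth part_al.
Qed.

Lemma leq_sumn_nth al lam : (forall j, nth 0 al j <= nth 0 lam j) -> sumn al <= sumn lam.
Proof.
move=> le_al; rewrite (sumn_nth (leq_maxl (size al) (size lam))).
by rewrite (sumn_nth (leq_maxr (size al) (size lam))) leq_sum.
Qed.

Lemma sumn_nth_le (lam : seq (seq nat)) r : sumn (nth [::] lam r) <= \sum_(l <- lam) sumn l.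
Proof.
elim: lam r => [|l lam IHlam] [|r] //=; rewrite big_cons ?leq_addr //.
exact: leq_trans (IHlam r) (leq_addl _ _).
Qed.

Lemma mem_prodseq_partsle k m lam :
  (lam \in prodseq k (partsle m)) = is_partk k lam && all (fun l => sumn l <= m) lam.
Proof.
rewrite mem_prodseq /is_partk -andbA -all_predI; congr (_ && _).
by apply: eq_all => l; rewrite /= mem_partsle.
Qed.

Definition pairs_lam_al k m :=
  [seq (lam, al) | lam <- prodseq k (partsle m), al <- prodseq k (partsle m)].

(* For fixed T, the pairs (lambda, alpha) are parametrized by the partition mu = lambda_1 - lambda_min(T). *)
Lemma count_CLRtuple nu T m : 0 < size nu -> SST_tuple nu T -> balanced T ->
  count (fun p => (\sum_(l <- p.1) sumn l == m) && CLRtupleb p.1 p.2 nu T)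
    (pairs_lam_al (size nu) m) =
  count (fun mu => (expo T + Posz (size nu * sumn mu) == Posz m)%R) (partsle m).
Proof.
move=> nu_gt0 SST_T bal_T; have [sz_T _] := SST_T.
have uniqL := uniq_prodseq (size nu) (uniq_partsle m).
apply: (@count_image _ _ _ _ _ _ (fun mu => (shift_lam T mu, shift_al T mu))).
- by apply: allpairs_uniq => // -[? ?] [? ?] _ _ /= [-> ->].
- exact: uniq_partsle.
- move=> mu; rewrite mem_partsle => /andP[part_mu _] expo_mu.
  have [part_lam part_al sh] := shiftP T part_mu.
  have := sum_sumn_shifted part_lam part_mu sh; rewrite sz_T (eqP expo_mu) => -[sum_lam].
  have clr := shifted_CLRtuple nu_gt0 SST_T bal_T part_mu sh.
  split; last by rewrite sum_lam eqxx; apply/CLRtupleP.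
  have le_lam r : sumn (nth [::] (shift_lam T mu) r) <= m.
    by rewrite -sum_lam sumn_nth_le.
  rewrite mem_allpairs_pair !mem_prodseq_partsle -sz_T part_lam part_al /=.
  apply/andP; split; apply/(all_nthP [::]) => // r; rewrite size_mkseq => lt_r.
  (* The size of alpha_r is bounded through its containment in lambda_r, given by the weight
     equation. *)
  apply: leq_trans (le_lam r); apply: leq_sumn_nth => j.
  rewrite sz_T in lt_r; have [/CLR_nat[_ _ wt1] _] := clr r lt_r.
  by rewrite -wt1 leq_addr.
- move=> mu mu' /andP[/= + _] /andP[/= + _].
  rewrite !mem_partsle => /andP[part_mu _] /andP[part_mu' _].
  have [_ _ sh] := shiftP T part_mu; have [_ _ sh'] := shiftP T part_mu' => -[eq_lam _].
  have T_gt0 : 0 < size T by rewrite sz_T.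
  apply: pv_inj => // j j_gt0.
  have [] := sh 0 j T_gt0 j_gt0; have [] := sh' 0 j T_gt0 j_gt0.
  by rewrite eq_lam => -> _ /addrI ->.
move=> [lam al]; rewrite mem_allpairs_pair !mem_prodseq_partsle /=.
case/andP=> /andP[part_lam _] /andP[part_al _] /andP[/eqP sum_lam /CLRtupleP clr].
have [_ _ [mu [part_mu sh]]] := CLRtuple_shifted nu_gt0 sz_T part_lam clr.
have [part_lam' part_al' sh'] := shiftP T part_mu.
rewrite -sz_T in part_lam part_al.
have := sum_sumn_shifted part_lam part_mu sh; rewrite sum_lam sz_T => sum_mu.
exists mu; rewrite -sum_mu eqxx mem_partsle part_mu; split=> //.
  (* As k >= 1 and the exponent of T is nonnegative, |mu| <= k |mu| <= m. *)
  have := expo_ge0 T; have : sumn mu <= size nu * sumn mu by rewrite leq_pmull.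
  by lia.
have nth_ext l l' : is_partk (size T) l -> is_partk (size T) l' ->
    (forall r j, r < size T -> 0 < j -> pv (nth [::] l r) j = pv (nth [::] l' r) j) -> l = l'.
  move=> part_l part_l' eq_l; have /andP[/eqP sz_l _] := part_l.
  have /andP[/eqP sz_l' _] := part_l'; apply: (@eq_from_nth _ [::]); first by rewrite sz_l.
  rewrite sz_l => r lt_r; apply: pv_inj; try exact: is_partk_nth part_l || exact: is_partk_nth part_l'.
  by move=> j; apply: eq_l.
congr (_, _); apply: nth_ext => // r j lt_r j_gt0.
  by have [-> _] := sh r j lt_r j_gt0; have [-> _] := sh' r j lt_r j_gt0.
by have [_ ->] := sh r j lt_r j_gt0; have [_ ->] := sh' r j lt_r j_gt0.
Qed.

Lemma count_shifts (k e m : nat) : 0 < k ->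
  Posz (count (fun mu => e + k * sumn mu == m) (partsle m)) =
  (if (e <= m)%N then scaled_parts k (m - e)%N else 0)%R.
Proof.
move=> k_gt0; rewrite /scaled_parts; case: leqP => [le_em|lt_me]; last first.
  rewrite (@eq_count _ _ pred0) ?count_pred0 // => mu /=; apply/eqP; lia.
case: ifP => [/dvdnP[c def_m]|ndvd]; last first.
  rewrite (@eq_count _ _ pred0) ?count_pred0 // => mu /=; apply/eqP => def_m.
  by move: ndvd; rewrite -def_m addKn dvdn_mulr.
rewrite def_m mulnK // -count_predT; congr Posz.
apply: (@count_image _ _ _ _ _ _ id); rewrite ?uniq_partsle ?uniq_parts //.
  move=> mu; rewrite mem_parts mem_partsle => /andP[-> /eqP->] _ /=.
  have -> : e + k * c = m by rewrite mulnC -def_m subnKC.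
  by rewrite eqxx; split=> //; rewrite -[m](subnKC le_em) def_m; nia.
move=> mu; rewrite mem_partsle => /andP[part_mu _] /eqP eq_m; exists mu; split=> //.
rewrite mem_parts part_mu /= -(eqn_pmul2l k_gt0); apply/eqP.
by rewrite [k * c]mulnC -def_m -eq_m addKn.
Qed.

Lemma wtT_bndT T j : bndT T < j -> (\sum_(0 <= s < size T) wtT T s j = 0)%R.
Proof. by move=> lt_j; rewrite big1 // => s _; rewrite wtT_eq0 // ltnW. Qed.

Definition balancedb T :=
  all (fun j => \sum_(0 <= s < size T) wtT T s j == 0)%R (iota 1 (bndT T)).

Lemma balancedP T : reflect (balanced T) (balancedb T).
Proof.
apply: (iffP allP) => [bal j j_gt0|bal j].
  have [le_j|/wtT_bndT//] := leqP j (bndT T).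
  by apply/eqP/bal; rewrite mem_iota j_gt0 add1n ltnS.
by rewrite mem_iota => /andP[j_gt0 _]; rewrite bal.
Qed.

(** Exchange of the sums over (lambda, alpha) and over T; unbalanced T admit no pair. [N] may exceed
    [m] so that one list of T serves every term of the convolution with [Pcoef]. *)
Lemma Acoef_ttabs nu N m : 0 < size nu ->
    all (fun p => is_part p.1 && is_part p.2) nu -> m <= N ->
  Acoef (size nu) nu m = (\sum_(T <- ttabs N nu)
    if balancedb T && (`|expo T| <= m)%N then scaled_parts (size nu) (m - `|expo T|)%N else 0)%R.
Proof.
move=> nu_gt0 part_nu le_mN; set k := size nu.
have Posz_count (T : Type) (P : pred T) s : Posz (count P s) = (\sum_(x <- s) Posz (P x))%R.
  by rewrite -sum1_count big_mkcond (big_morph Posz PoszD (erefl _)); apply: eq_bigr => x _; case: (P x).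
transitivity (\sum_(T <- ttabs N nu) Posz (count
    (fun p => (\sum_(l <- p.1) sumn l == m)%N && CLRtupleb p.1 p.2 nu T) (pairs_lam_al k m)))%R.
  transitivity (\sum_(p <- pairs_lam_al k m) \sum_(T <- ttabs N nu)
     Posz ((\sum_(l <- p.1) sumn l == m)%N && CLRtupleb p.1 p.2 nu T))%R; last first.
    by rewrite exchange_big; apply: eq_bigr => T _; rewrite Posz_count.
  rewrite /pairs_lam_al big_allpairs_dep /Acoef [LHS]big_mkcond; apply: eq_big_seq => lam lam_in.
  case: ifP => [sum_lam|_]; last by rewrite big1 // => al _; rewrite big1.
  apply: eq_big_seq => al al_in; rewrite -Posz_count.
  move: lam_in al_in; rewrite !mem_prodseq_partsle => /andP[part_lam _] /andP[part_al _].
  apply: prod_LR => // r; apply: leq_trans le_mN; rewrite -(eqP sum_lam).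
  exact: leq_trans (size_part_le (is_partk_nth r part_lam)) (sumn_nth_le _ _).
apply: eq_big_seq => T /mem_ttabs[SST_T _]; have [sz_T _] := SST_T.
case: balancedP => [bal_T|nbal] /=.
  rewrite count_CLRtuple // -count_shifts //; congr Posz; apply: eq_count => mu.
  by have := expo_ge0 T => ?; apply/eqP/eqP; lia.
rewrite (@eq_in_count _ _ pred0) ?count_pred0 // => -[lam al].
rewrite mem_allpairs_pair !mem_prodseq_partsle /= => /andP[/andP[part_lam _] _].
apply/negP => /andP[_ /CLRtupleP clr]; case: nbal.
by have [] := CLRtuple_shifted nu_gt0 sz_T part_lam clr.
Qed.

(** By the weight equation an entry x+1 forces part number x+1 of lambda to be nonzero, so x+1 is at
    most the number of parts. *)
Lemma CLR_entries lam al nu t : is_part lam -> CLR lam al nu t ->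
  all (leq^~ (sumn lam)) (flatten t).
Proof.
move=> part_lam /CLR_nat[_ _ wt_t]; apply/allP => -[|x] // t_x.
apply: leq_trans (size_part_le part_lam); rewrite -part_nth_gt0 // -wt_t.
by rewrite addn_gt0 orbC -has_count has_pred1 t_x.
Qed.

(** The identity of power series is read coefficientwise; the list [s] also certifies that finitely
    many distinguished T have a given exponent, so that the right-hand side makes sense. *)
Theorem mainTheorem12 (k : nat) (nu : seq (seq nat * seq nat)) :
  (0 < k)%N -> size nu = k ->
  all (fun p => is_part p.1 && is_part p.2) nu ->
  forall n : nat,
    exists s : seq ttab,
      [/\ uniq s,
          forall T, T \in s <-> (distinguished k nu T /\ expo T = Posz n) &
          Posz (size s) = minf k nu n].
Proof.
move=> k_gt0 sz_nu part_nu n; have nu_gt0 : 0 < size nu by rewrite sz_nu.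
exists [seq T <- ttabs n nu | balancedb T && (`|expo T| == n)%N]; split.
- by rewrite filter_uniq ?uniq_ttabs.
- move=> T; rewrite -sz_nu distinguishedP // mem_filter; have expo_T := expo_ge0 T.
  split=> [/andP[/andP[/balancedP bal_T /eqP <-] /mem_ttabs[SST_T _]]|].
    by split=> //; rewrite gez0_abs.
  case=> -[SST_T bal_T] def_n; rewrite def_n eqxx andbT; have [sz_T _] := SST_T.
  apply/andP; split; first exact/balancedP.
  have [part_lam _ sh] := @shiftP T [::] isT.
  have := sum_sumn_shifted (mu := [::]) part_lam isT sh.
  rewrite muln0 addr0 def_n => -[sum_lam].
  have clr := shifted_CLRtuple (mu := [::]) nu_gt0 SST_T bal_T isT sh.
  (* The tuple lambda(T) has n boxes in all and is compatible with T, so no entry of T exceeds n. *)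
  have le_n r al nu_r t : CLR (nth [::] (shift_lam T [::]) r) al nu_r t -> all (leq^~ n) (flatten t).
    move=> /(CLR_entries (is_partk_nth r part_lam)); apply: sub_all => x le_x.
    by rewrite -sum_lam (leq_trans le_x) ?sumn_nth_le.
  by apply/mem_ttabs; split=> // r /clr[/le_n-> /le_n->].
rewrite /minf (eq_bigr (fun j : 'I_n.+1 => \sum_(T <- ttabs n nu) Pcoef k j *
    (if balancedb T && (`|expo T| <= n - j)%N then scaled_parts k (n - j - `|expo T|)%N else 0)))%R;
  last first.
  by move=> j _; rewrite -sz_nu (Acoef_ttabs nu_gt0 part_nu (leq_subr j n)) mulr_sumr.
rewrite exchange_big size_filter -sum1_count big_mkcond (big_morph Posz PoszD (erefl _)) /=.
apply: eq_bigr => T _; case: (balancedb T) => /=; last by rewrite big1 // => j _; rewrite mulr0.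
set e := `|expo T|%N; have [le_en|lt_ne] := leqP e n; last first.
  by rewrite gtn_eqF // big1 // => j _; rewrite ifF ?mulr0 //; lia.
rewrite -(big_mkord xpredT (fun j => Pcoef k j *
  (if (e <= n - j)%N then scaled_parts k (n - j - e)%N else 0))%R).
(* Terms with j > n - e vanish. What remains is the convolution in degree n - e, which is 1 if e = n
   and 0 otherwise. *)
rewrite (@big_cat_nat _ _ _ (n - e).+1) //=; last by rewrite ltnS leq_subr.
rewrite [X in (_ + X)%R]big1_seq ?addr0 => [|j]; last first.
  by rewrite mem_index_iota => /andP[_ lt_j]; rewrite ifF ?mulr0 //; lia.
rewrite (@eq_big_nat _ _ _ _ _ _ (fun j => Pcoef k j * scaled_parts k (n - e - j)%N)%R) => [|j lt_j].
  by rewrite euler_inverse // subn_eq0 eqn_leq le_en /=; case: leqP.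
by rewrite ifT; [rewrite -!subnDA addnC | lia].
Qed.
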